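(* Let $\mathcal{V}$ be a variety with a weak difference term and let $\mathbf{A},\mathbf{B}\in\mathcal{V}$ be subdirectly irreducible. The following are equivalent: (1) $\mathbf{A}\sim\mathbf{B}$. (2) There exist $\mathbf{C}\in\mathcal{V}$, surjective homomorphisms $f_1:\mathbf{C}\to\mathbf{A}$, $f_2:\mathbf{C}\to\mathbf{B}$, and congruences $\psi<\tau$ of $\mathbf{C}$ such that, with $\delta_i=\ker(f_i)$ and $\delta_i^+$ the unique upper cover of $\delta_i$ in $\mathrm{Con}(\mathbf{C})$ ($i=1,2$), we have $\tau\wedge\delta_i=\psi$ and $\tau\vee\delta_i=\delta_i^+$ for $i=1,2$. (3) There exist a subdirect product $\mathbf{C}\le_{sd}\mathbf{A}\times\mathbf{B}$ and a congruence $\tau$ of $\mathbf{C}$ with $0_C<\tau$ such that, with $\delta_1,\delta_2$ the kernels of the projections $\mathbf{C}\to\mathbf{A}$, $\mathbf{C}\to\mathbf{B}$ and $\delta_i^+$ the unique upper cover of $\delta_i$, we have $\tau\wedge\delta_i=0_C$ and $\tau\vee\delta_i=\delta_i^+$ for $i=1,2$. (4) There exists a similarity bridge from $\mathbf{A}$ to $\mathbf{B}$.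
   Context: $C(\varphi,\theta;\delta)$ means: for every term $t(\bar x,\bar y)$, all $(a_i,b_i)\in\varphi$, $(c_j,d_j)\in\theta$, if $t(\bar a,\bar c)\equiv_\delta t(\bar a,\bar d)$ then $t(\bar b,\bar c)\equiv_\delta t(\bar b,\bar d)$. $(0:\theta)$ is the largest $\varphi$ with $C(\varphi,\theta;0)$; $\theta$ abelian iff $C(\theta,\theta;0)$; $\theta/\delta$ abelian iff $C(\theta,\theta;\delta)$. A weak difference term for $\mathcal{V}$ is an idempotent ternary term $d$ such that in every member, for all congruences $\delta\le\theta$ with $\theta/\delta$ abelian, $d(a,a,b)\equiv_\delta b\equiv_\delta d(b,a,a)$ for $(a,b)\in\theta$. For an algebra $\mathbf{A}$ and abelian $\theta$ with $\alpha=(0:\theta)$: $\mathbf{A}(\theta)$ is $\theta$ as a subalgebra of $\mathbf{A}^2$, $\Delta_{\theta,\alpha}$ is the congruence of $\mathbf{A}(\theta)$ generated by $\{((a,a),(b,b)):(a,b)\in\alpha\}$, and the difference algebra is $D(\mathbf{A},\theta)=\mathbf{A}(\theta)/\Delta_{\theta,\alpha}$. For subdirectly irreducible $\mathbf{A}$ with monolith $\mu$, $D(\mathbf{A})=\mathbf{A}$ if $\mu$ is nonabelian and $D(\mathbf{A})=D(\mathbf{A},\mu)$ if $\mu$ is abelian; $\mathbf{A}\sim\mathbf{B}$ (similar) means $D(\mathbf{A})\cong D(\mathbf{B})$. For subdirectly irreducible $\mathbf{A},\mathbf{B}$ with monoliths $\mu,\kappa$, a similarity bridge from $\mathbf{A}$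 to $\mathbf{B}$ is a subuniverse $T\le\mathbf{A}\times\mathbf{A}\times\mathbf{B}\times\mathbf{B}$ with (B1) projection onto coordinates $1,2$ equal to $\mu$ and onto $3,4$ equal to $\kappa$; (B2) for $(a_1,a_2,b_1,b_2)\in T$, $a_1=a_2$ iff $b_1=b_2$; (B3) for $(a_1,a_2,b_1,b_2)\in T$, $(a_i,a_i,b_i,b_i)\in T$ for $i=1,2$. (Since $\mathbf{A},\mathbf{B}$ are subdirectly irreducible, the kernels $\delta_i$ in (2),(3) are completely meet-irreducible and so have unique upper covers.) *)

(* Defs.v *)
From mathcomp Require Import all_boot.
From mathcomp Require Import boolp.

Set Implicit Arguments.
Unset Strict Implicit.
Unset Printing Implicit Defensive.

Record signature := Signature { symb : Type; arity : symb -> nat }.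

(* Universes of algebras are nonempty; subuniverses (below) may be empty. *)
Record algebra (S : signature) := Algebra {
  carrier :> Type;
  opn : forall o : symb S, ('I_(arity o) -> carrier) -> carrier;
  algebra_inhabited : inhabited carrier
}.
Arguments opn {S a} o x.

Inductive term (S : signature) (X : Type) :=
| Var of X
| App (o : symb S) of ('I_(arity o) -> term S X).
Arguments Var {S X}.
Arguments App {S X} o _.

Fixpoint eval (S : signature) (A : algebra S) (X : Type) (e : X -> A)
    (t : term S X) : A :=
  match t with
  | Var x => e x
  | App o ts => opn o (fun i => eval e (ts i))
  end.

Definition is_hom (S : signature) (A B : algebra S) (f : A -> B) :=
  forall (o : symb S) (x : 'I_(arity o) -> A),
    f (opn o x) = opn o (fun i => f (x i)).

Record hom (S : signature) (A B : algebra S) := Hom {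
  hom_fun :> A -> B;
  hom_is_hom : is_hom hom_fun
}.

Definition onto (X Y : Type) (f : X -> Y) := forall y, exists x, f x = y.

Definition isomorphic (S : signature) (A B : algebra S) :=
  exists f : hom A B, bijective f.

Definition prod_alg (S : signature) (A B : algebra S) : algebra S :=
  @Algebra S (A * B)%type
    (fun o x => (opn o (fun i => (x i).1), opn o (fun i => (x i).2)))
    (inhabits (inhabited_witness (algebra_inhabited A),
               inhabited_witness (algebra_inhabited B))).

Definition big_prod_alg (S : signature) (I : Type) (F : I -> algebra S) :
    algebra S :=
  @Algebra S (forall i, F i)
    (fun o x i => opn o (fun k => x k i))
    (inhabits (fun i => inhabited_witness (algebra_inhabited (F i)))).

Record subuniverse (S : signature) (A : algebra S) := Subuniverse {
  subu_pred :> A -> Prop;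
  subu_closed : forall (o : symb S) (x : 'I_(arity o) -> A),
    (forall i, subu_pred (x i)) -> subu_pred (opn o x)
}.

Lemma subalg_inhabited (S : signature) (A : algebra S) (U : subuniverse A) :
  (exists x, U x) -> inhabited {x : A | U x}.
Proof. by case=> x Ux; exact: inhabits (exist _ x Ux). Qed.

Definition subalg (S : signature) (A : algebra S) (U : subuniverse A)
    (U0 : exists x, U x) : algebra S :=
  @Algebra S {x : A | U x}
    (fun o x => exist _ (opn o (fun i => sval (x i)))
                        (subu_closed (fun i => svalP (x i))))
    (subalg_inhabited U0).

Section SubProduct.
Variables (S : signature) (A B : algebra S) (U : subuniverse (prod_alg A B)).
Variable U0 : exists x, U x.

Definition sub_fst : hom (subalg U0) A :=
  @Hom S (subalg U0) A (fun x => (sval x).1) (fun _ _ => erefl).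

Definition sub_snd : hom (subalg U0) B :=
  @Hom S (subalg U0) B (fun x => (sval x).2) (fun _ _ => erefl).

Definition subdirect := onto sub_fst /\ onto sub_snd.

End SubProduct.

Record variety (S : signature) (V : algebra S -> Prop) : Prop := Variety {
  variety_H : forall (A B : algebra S) (f : hom A B), onto f -> V A -> V B;
  variety_S : forall (A : algebra S) (U : subuniverse A)
    (U0 : exists x, U x), V A -> V (subalg U0);
  variety_P : forall (I : Type) (F : I -> algebra S),
    (forall i, V (F i)) -> V (big_prod_alg F)
}.

Record congruence (S : signature) (A : algebra S) := Congruence {
  con_rel :> A -> A -> Prop;
  con_refl : forall x, con_rel x x;
  con_sym : forall x y, con_rel x y -> con_rel y x;
  con_trans : forall x y z, con_rel x y -> con_rel y z -> con_rel x z;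
  con_opn : forall (o : symb S) (x y : 'I_(arity o) -> A),
    (forall i, con_rel (x i) (y i)) -> con_rel (opn o x) (opn o y)
}.

(* Leibniz equality of congruences is equality of the underlying relations. *)
Lemma con_ext (S : signature) (A : algebra S) (theta phi : congruence A) :
  (forall x y, theta x y <-> phi x y) -> theta = phi.
Proof.
case: theta => r r1 r2 r3 r4; case: phi => s s1 s2 s3 s4 /= rs.
have E : r = s by apply/funext => x; apply/funext => y; apply/propext.
by subst s; congr Congruence; exact: Prop_irrelevance.
Qed.

Section ConLattice.
Variables (S : signature) (A : algebra S).
Implicit Types theta phi : congruence A.

Definition con_le theta phi := forall x y, theta x y -> phi x y.
Definition con_lt theta phi := con_le theta phi /\ theta <> phi.

Program Definition con0 : congruence A := @Congruence S A eq _ _ _ _.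
Next Obligation. by congr opn; exact/funext. Qed.

Program Definition con_inf (P : congruence A -> Prop) : congruence A :=
  @Congruence S A (fun x y => forall theta, P theta -> theta x y) _ _ _ _.
Next Obligation. exact: con_refl. Qed.
Next Obligation. by apply: con_sym; exact: H. Qed.
Next Obligation. by apply: (@con_trans _ _ _ _ y); [exact: H|exact: H0]. Qed.
Next Obligation. by apply: con_opn => i; exact: H. Qed.

Definition con_sup (P : congruence A -> Prop) : congruence A :=
  con_inf (fun theta => forall phi, P phi -> con_le phi theta).

Definition con_gen (R : A -> A -> Prop) : congruence A :=
  con_inf (fun theta => forall x y, R x y -> theta x y).

Program Definition con_meet theta phi : congruence A :=
  @Congruence S A (fun x y => theta x y /\ phi x y) _ _ _ _.
Next Obligation. by split; exact: con_refl. Qed.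
Next Obligation. by split; exact: con_sym. Qed.
Next Obligation. by split; apply: (@con_trans _ _ _ _ y). Qed.
Next Obligation. by split; apply: con_opn => i; case: (H i). Qed.

Definition con_join theta phi : congruence A :=
  con_sup (fun psi => psi = theta \/ psi = phi).

Definition upper_cover theta phi :=
  con_lt theta phi /\
  forall psi, con_le theta psi -> con_le psi phi -> psi = theta \/ psi = phi.

Definition unique_upper_cover theta phi :=
  upper_cover theta phi /\ forall psi, upper_cover theta psi -> psi = phi.

Definition is_monolith mu :=
  mu <> con0 /\ forall theta, theta <> con0 -> con_le mu theta.

(* The meet of all nonzero congruences; see [monolithP]. *)
Definition monolith : congruence A := con_inf (fun theta => theta <> con0).

End ConLattice.
Arguments con0 {S A}.
Arguments monolith {S} A.

Program Definition con_ker (S : signature) (A B : algebra S) (f : hom A B) :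
    congruence A :=
  @Congruence S A (fun x y => f x = f y) _ _ _ _.
Next Obligation. by rewrite !hom_is_hom; congr opn; exact/funext. Qed.

(* Subdirect irreducibility in the sense that excludes one-element algebras. *)
Definition subdirectly_irreducible (S : signature) (A : algebra S) :=
  exists mu : congruence A, is_monolith mu.

Lemma monolithP (S : signature) (A : algebra S) :
  subdirectly_irreducible A -> is_monolith (monolith A).
Proof.
case=> mu [mu0 mule]; suff -> : monolith A = mu by split.
by apply: con_ext => x y; split=> [h|h theta /mule]; [exact: h|exact].
Qed.

Section Quotient.
Variables (S : signature) (A : algebra S) (theta : congruence A).

Definition quot_type := {P : A -> Prop | exists x, P = theta x}.

Definition quot_class (x : A) : quot_type :=
  exist _ (con_rel theta x) (ex_intro _ x erefl).

Definition quot_repr (c : quot_type) : A := projT1 (cid (svalP c)).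

Definition quot_alg : algebra S :=
  @Algebra S quot_type
    (fun o c => quot_class (opn o (fun i => quot_repr (c i))))
    (inhabits (quot_class (inhabited_witness (algebra_inhabited A)))).

Lemma quot_classP x y : quot_class x = quot_class y <-> theta x y.
Proof.
split=> [[E]|xy]; first by rewrite E; exact: con_refl.
apply: eq_exist; apply/funext => z; apply/propext; split.
  by apply: con_trans; exact: con_sym.
exact: con_trans.
Qed.

Lemma quot_reprK c : quot_class (quot_repr c) = c.
Proof.
case: c => P HP; apply: eq_exist; rewrite /quot_repr /=.
by case: cid => x /= ->.
Qed.

Lemma quot_class_hom : @is_hom S A quot_alg quot_class.
Proof.
move=> o x; apply/quot_classP; apply: con_opn => i.
by apply/quot_classP; rewrite quot_reprK.
Qed.

End Quotient.

Definition env2 (X Y T : Type) (a : X -> T) (c : Y -> T) (v : X + Y) : T :=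
  match v with inl i => a i | inr j => c j end.

Section Centrality.
Variables (S : signature) (A : algebra S).
Implicit Types theta phi delta : congruence A.

Definition centralizes phi theta delta :=
  forall (m n : nat) (t : term S ('I_m + 'I_n))
    (a b : 'I_m -> A) (c d : 'I_n -> A),
    (forall i, phi (a i) (b i)) -> (forall j, theta (c j) (d j)) ->
    delta (eval (env2 a c) t) (eval (env2 a d) t) ->
    delta (eval (env2 b c) t) (eval (env2 b d) t).

Definition abelian theta := centralizes theta theta con0.

(* (0 : theta); see [annihilatorP] for the fact that it is the largest
   congruence centralizing theta. *)
Definition annihilator theta : congruence A :=
  con_sup (fun phi => centralizes phi theta con0).

End Centrality.

Lemma eval_ext (S : signature) (A : algebra S) (X : Type) (e f : X -> A) t :
  e =1 f -> eval e t = eval f t.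
Proof. by move=> /funext ->. Qed.

Fixpoint subst (S : signature) (X Y : Type) (s : X -> term S Y)
    (t : term S X) : term S Y :=
  match t with
  | Var x => s x
  | App o ts => App o (fun i => subst s (ts i))
  end.

Lemma eval_subst (S : signature) (A : algebra S) (X Y : Type)
    (s : X -> term S Y) (e : Y -> A) (t : term S X) :
  eval e (subst s t) = eval (fun x => eval e (s x)) t.
Proof. by elim: t => //= o ts IH; congr opn; apply/funext => i; exact: IH. Qed.

Section CentralizerSup.
Variables (S : signature) (A : algebra S) (theta delta : congruence A).

Let upd m (e : 'I_m -> A) (i : 'I_m) (x : A) (j : 'I_m) :=
  if j == i then x else e j.

Let exch m (a b : 'I_m -> A) := forall n (t : term S ('I_m + 'I_n)) c d,
  (forall j, theta (c j) (d j)) ->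
  delta (eval (env2 a c) t) (eval (env2 a d) t) <->
  delta (eval (env2 b c) t) (eval (env2 b d) t).

Let R (x y : A) := forall m (i : 'I_m) (e : 'I_m -> A),
  exch (upd e i x) (upd e i y).

Let R_exch m (a b : 'I_m -> A) : (forall i, R (a i) (b i)) -> exch a b.
Proof.
move=> ab; pose h k (j : 'I_m) := if j < k then b j else a j.
have -> : b = h m by apply/funext => j; rewrite /h ltn_ord.
suff : forall k, k <= m -> exch a (h k) by apply.
elim=> [_|k IH km] n t c d cd.
  by have -> : h 0 = a by exact/funext.
apply: iff_trans (IH (ltnW km) n t c d cd) _.
have -> : h k = upd (h k) (Ordinal km) (a (Ordinal km)).
  apply/funext => j; rewrite /upd /h; case: eqP => // ->.
  by rewrite /= ltnn.
have -> : h k.+1 = upd (h k) (Ordinal km) (b (Ordinal km)).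
  apply/funext => j; rewrite /upd /h ltnS leq_eqVlt -val_eqE /=.
  by case: eqP => // E; congr b; exact/val_inj.
exact: ab.
Qed.

Let R_opn (o : symb S) (x y : 'I_(arity o) -> A) :
  (forall i, R (x i) (y i)) -> R (opn o x) (opn o y).
Proof.
move=> xy m i e n t c d cd.
pose s (v : 'I_m + 'I_n) : term S ('I_(m + arity o) + 'I_n) :=
  match v with
  | inl j => if j == i then App o (fun k => Var (inl (rshift m k)))
             else Var (inl (lshift (arity o) j))
  | inr j => Var (inr j)
  end.
pose g (z : 'I_(arity o) -> A) (j : 'I_(m + arity o)) :=
  match split j with inl k => e k | inr k => z k end.
have gE z w : eval (env2 (upd e i (opn o z)) w) t
            = eval (env2 (g z) w) (subst s t).
  rewrite eval_subst; apply: eval_ext => -[j|j] //=; rewrite /upd.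
  case: ifP => _ /=; rewrite /g; last by rewrite (unsplitK (inl j)).
  by congr opn; apply/funext => k; rewrite (unsplitK (inr k)).
rewrite !gE; apply: R_exch => // j; rewrite /g; case: split => // k.
Qed.

Lemma centralizes_sup (P : congruence A -> Prop) :
  (forall phi, P phi -> centralizes phi theta delta) ->
  centralizes (con_sup P) theta delta.
Proof.
move=> HP.
have R1 x : R x x by move=> ? ? ? ? ? ? ? _.
have R2 x y : R x y -> R y x.
  by move=> xy m i e n t c d cd; apply: iff_sym; exact: xy.
have R3 x y z : R x y -> R y z -> R x z.
  by move=> xy yz m i e n t c d cd; apply: iff_trans (xy _ _ _ _ _ _ _ cd) _;
     exact: yz.
pose rho := Congruence R1 R2 R3 R_opn.
have Prho phi : P phi -> con_le phi rho.
  move=> /HP cphi x y xy m i e n t c d cd.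
  have updxy z w j : phi z w -> phi (upd e i z j) (upd e i w j).
    by rewrite /upd; case: ifP => // _ _; exact: con_refl.
  split; apply: cphi => // j; apply: updxy => //; exact: con_sym.
move=> m n t a b c d ab cd.
have : exch a b by apply: R_exch => i; exact: (ab i rho).
by move=> /(_ _ t c d cd) [].
Qed.

End CentralizerSup.

Lemma annihilatorP (S : signature) (A : algebra S) (theta : congruence A) :
  centralizes (annihilator theta) theta con0 /\
  forall phi, centralizes phi theta con0 -> con_le phi (annihilator theta).
Proof.
split; first exact: centralizes_sup.
by move=> phi hphi x y xy psi h; exact: (h phi hphi x y xy).
Qed.

Definition eval3 (S : signature) (A : algebra S) (t : term S 'I_3)
    (x y z : A) : A :=
  eval (tnth [tuple x; y; z]) t.

(* [centralizes theta theta delta] says that theta / delta is abelian. *)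
Definition weak_difference_term (S : signature) (V : algebra S -> Prop)
    (d : term S 'I_3) :=
  forall A : algebra S, V A ->
    (forall x : A, eval3 d x x x = x) /\
    forall delta theta : congruence A,
      con_le delta theta -> centralizes theta theta delta ->
      forall a b : A, theta a b ->
        delta (eval3 d a a b) b /\ delta b (eval3 d b a a).

Section DifferenceAlgebra.
Variables (S : signature) (A : algebra S).

Definition con_subu (theta : congruence A) : subuniverse (prod_alg A A) :=
  @Subuniverse S (prod_alg A A) (fun p => theta p.1 p.2)
    (fun o x h => con_opn h).

Lemma con_subu_nonempty (theta : congruence A) : exists p, con_subu theta p.
Proof.
by case: (algebra_inhabited A) => x; exists (x, x); exact: con_refl.
Qed.

Definition con_alg (theta : congruence A) : algebra S :=
  subalg (con_subu_nonempty theta).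

Definition con_diag (theta : congruence A) (x : A) : con_alg theta :=
  exist _ (x, x) (con_refl theta x).

Definition Delta (theta alpha : congruence A) : congruence (con_alg theta) :=
  con_gen (fun p q => exists a b : A,
    [/\ alpha a b, p = con_diag theta a & q = con_diag theta b]).

Definition difference_algebra_at (theta : congruence A) : algebra S :=
  quot_alg (Delta theta (annihilator theta)).

Definition difference_algebra : algebra S :=
  if pselect (abelian (monolith A))
  then difference_algebra_at (monolith A) else A.

End DifferenceAlgebra.

Definition similar (S : signature) (A B : algebra S) :=
  isomorphic (difference_algebra A) (difference_algebra B).

(* A * A * B * B is represented as (A * A) * (B * B). *)
Record similarity_bridge (S : signature) (A B : algebra S)
    (T : subuniverse (prod_alg (prod_alg A A) (prod_alg B B))) : Prop :=
  SimilarityBridge {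
  bridge_fst : forall a1 a2,
    (exists b1 b2, T ((a1, a2), (b1, b2))) <-> monolith A a1 a2;
  bridge_snd : forall b1 b2,
    (exists a1 a2, T ((a1, a2), (b1, b2))) <-> monolith B b1 b2;
  bridge_eq : forall a1 a2 b1 b2,
    T ((a1, a2), (b1, b2)) -> (a1 = a2 <-> b1 = b2);
  bridge_diag : forall a1 a2 b1 b2, T ((a1, a2), (b1, b2)) ->
    T ((a1, a1), (b1, b1)) /\ T ((a2, a2), (b2, b2))
}.

(* Main.v *)
Require Import Defs.
From mathcomp Require Import all_boot.
From mathcomp Require Import boolp.

(* The centralizer condition C(phi, theta; delta) is tested on "twins", pairs of
   unary polynomials that differ only in theta-related parameters; twins can be
   carried along compatible relations, so centrality passes between A, B, C,
   bridges and their subpowers without any modularity of congruence lattices.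

   For abelian theta, two elements of A(theta) over the same class of
   (0 : theta) can be moved by d within their Delta-classes to pairs with a
   common first coordinate, and Delta is equality on pairs with a given first
   coordinate.  Hence, for a monolith mu, the kernel of A(mu) -> A / (0 : mu)
   induces the monolith of D(A, mu), which is abelian; so every isomorphism
   D(A) -> D(B) preserves it, and choosing common first coordinates turns the
   isomorphism into a bridge.  Conversely a bridge T carries (0 : mu) to
   (0 : kappa) and Delta to Delta.

   A bridge T is itself a congruence of C = {(a, b) | (a, a, b, b) in T}; and
   the image of tau in A^2 x B^2 is a bridge when tau / psi is abelian.  If a
   monolith is nonabelian, its annihilator is trivial, which forces the two
   kernels to coincide, so A and B are isomorphic. *)

Set Implicit Arguments.
Unset Strict Implicit.
Unset Printing Implicit Defensive.

(** * Terms under homomorphisms, congruences and subuniverses *)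

Section Evaluation.
Variable S : signature.
Implicit Types A B : algebra S.

Lemma eval_hom A B (f : hom A B) (X : Type) (e : X -> A) (t : term S X) :
  f (eval e t) = eval (f \o e) t.
Proof.
elim: t => //= o ts IH; rewrite hom_is_hom; congr opn.
by apply/funext => i; exact: IH.
Qed.

Lemma eval3_hom A B (f : hom A B) (t : term S 'I_3) (x y z : A) :
  f (eval3 t x y z) = eval3 t (f x) (f y) (f z).
Proof.
by rewrite /eval3 eval_hom; apply: eval_ext => -[[|[|[|//]]] ?].
Qed.

Lemma con_eval A (theta : congruence A) (X : Type) (e e' : X -> A)
    (t : term S X) :
  (forall x, theta (e x) (e' x)) -> theta (eval e t) (eval e' t).
Proof.
by move=> ee; elim: t => //= o ts IH; apply: con_opn => i; exact: IH.
Qed.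

Lemma con_eval3 A (theta : congruence A) (t : term S 'I_3) x x' y y' z z' :
  theta x x' -> theta y y' -> theta z z' ->
  theta (eval3 t x y z) (eval3 t x' y' z').
Proof. by move=> ? ? ?; apply: con_eval => -[[|[|[|//]]] ?]. Qed.

Lemma subu_eval3 A (U : subuniverse A) (t : term S 'I_3) x y z :
  U x -> U y -> U z -> U (eval3 t x y z).
Proof.
move=> Ux Uy Uz; rewrite /eval3.
have : forall i, U (tnth [tuple x; y; z] i) by move=> -[[|[|[|//]]] ?].
move: (tnth _) => e Ue {Ux Uy Uz}.
by elim: t => //= o ts IH; apply: subu_closed => i; exact: IH.
Qed.

Lemma eval3_prod A B (t : term S 'I_3) (x y z : prod_alg A B) :
  eval3 t x y z = (eval3 t x.1 y.1 z.1, eval3 t x.2 y.2 z.2).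
Proof.
pose f : hom (prod_alg A B) A := @Hom S (prod_alg A B) A fst (fun _ _ => erefl).
pose g : hom (prod_alg A B) B := @Hom S (prod_alg A B) B snd (fun _ _ => erefl).
rewrite [LHS]surjective_pairing; congr pair; first exact: (eval3_hom f).
exact: (eval3_hom g).
Qed.

End Evaluation.

(** * Centrality expressed through twin polynomials *)

Section Twins.
Variable S : signature.
Implicit Types A B : algebra S.

(* [twin r f g]: [f] and [g] are the unary polynomials t(x, c) and t(x, d) for
   a common term t and parameters with [r c_j d_j] for all j. *)
Inductive twin A (r : A -> A -> Prop) : (A -> A) -> (A -> A) -> Prop :=
| twin_id : twin r (fun x => x) (fun x => x)
| twin_cst c d : r c d -> twin r (fun=> c) (fun=> d)
| twin_opn (o : symb S) (F G : 'I_(arity o) -> A -> A) :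
    (forall i, twin r (F i) (G i)) ->
    twin r (fun x => opn o (fun i => F i x)) (fun x => opn o (fun i => G i x)).

Lemma twin_comp A (r : A -> A -> Prop) f g f' g' :
  twin r f g -> twin r f' g' -> twin r (f \o f') (g \o g').
Proof.
move=> fg fg'; elim: fg => [|c d cd|o F G _ IH] //; first exact: twin_cst.
exact: (@twin_opn _ _ o (fun i => F i \o f') (fun i => G i \o g')).
Qed.

Lemma twin_diag A (r : A -> A -> Prop) f g :
  (forall x, r x x) -> twin r f g -> twin r f f.
Proof.
move=> rr; elim=> [|c d cd|o F G _ IH]; first exact: twin_id.
  exact: twin_cst.
exact: twin_opn.
Qed.

Lemma twin_mono A (r s : A -> A -> Prop) f g :
  (forall x y, r x y -> s x y) -> twin r f g -> twin s f g.
Proof.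
move=> rs; elim=> [|c d /rs cd|o F G _ IH]; first exact: twin_id.
  exact: twin_cst.
exact: twin_opn.
Qed.

Lemma twin_con A (r : A -> A -> Prop) (theta : congruence A) f g :
  (forall x y, r x y -> theta x y) -> twin r f g ->
  forall x y, theta x y -> theta (f x) (g y).
Proof.
move=> rt; elim=> [|c d /rt|o F G _ IH] // x y xy.
by apply: con_opn => i; exact: IH.
Qed.

(** Replacing each parameter pair by a [T]-partner and keeping the operations gives the new twin.
    [T] has four places so that both polynomials travel together. *)
Lemma twin_transfer A B (rA : A -> A -> Prop) (rB : B -> B -> Prop)
    (T : A -> A -> B -> B -> Prop) :
  (forall o x y z w, (forall i, T (x i) (y i) (z i) (w i)) ->
    T (opn o x) (opn o y) (opn o z) (opn o w)) ->
  (forall c d, rB c d -> exists c' d', rA c' d' /\ T c' d' c d) ->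
  forall f g, twin rB f g -> exists f' g', twin rA f' g' /\
    forall x' y' x y, T x' y' x y -> T (f' x') (g' y') (f x) (g y).
Proof.
move=> Topn Tr f g; elim=> [|c d /Tr[c' [d' [r' T']]]|o F G _ IH].
- by exists id, id; split; first exact: twin_id.
- by exists (fun=> c'), (fun=> d'); split=> //; exact: twin_cst.
have {}IH i : exists fg : (A -> A) * (A -> A), twin rA fg.1 fg.2 /\
    forall x' y' x y, T x' y' x y -> T (fg.1 x') (fg.2 y') (F i x) (G i y).
  by have [f' [g' ?]] := IH i; exists (f', g').
have [h hP] := choice IH.
exists (fun x => opn o (fun i => (h i).1 x)),
       (fun x => opn o (fun i => (h i).2 x)); split.
  by apply: twin_opn => i; exact: (hP i).1.
by move=> x' y' x y xy; apply: Topn => i; exact: (hP i).2.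
Qed.

Definition linked A (r dl : A -> A -> Prop) (p q : A * A) :=
  forall f g, twin r f g -> dl (f p.1) (g p.2) <-> dl (f q.1) (g q.2).

(* Exchange the arguments one at a time. *)
Lemma linked_opn A (r dl : A -> A -> Prop) (o : symb S)
    (p q : 'I_(arity o) -> prod_alg A A) :
  (forall i, r (p i).1 (p i).2) -> (forall i, r (q i).1 (q i).2) ->
  (forall i, linked r dl (p i) (q i)) -> linked r dl (opn o p) (opn o q).
Proof.
move=> rp rq pq f g fg.
pose h k (i : 'I_(arity o)) : prod_alg A A := if i < k then q i else p i.
have -> : q = h (arity o) by apply/funext => i; rewrite /h ltn_ord.
suff : forall k, k <= arity o ->
  dl (f (opn o p).1) (g (opn o p).2) <->
  dl (f (opn o (h k)).1) (g (opn o (h k)).2) by apply.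
elim=> [_|k IH ko]; first by have -> : h 0 = p by exact/funext.
apply: iff_trans (IH (ltnW ko)) _; pose k0 := Ordinal ko.
pose u (z : prod_alg A A) i := if i == k0 then z else h k i.
have E1 : h k = u (p k0).
  by apply/funext => i; rewrite /u /h; case: eqP => // ->; rewrite ltnn.
have E2 : h k.+1 = u (q k0).
  apply/funext => i; rewrite /u /h ltnS leq_eqVlt -val_eqE /=.
  by case: eqP => //= ik; congr q; exact/val_inj.
pose F i (x : A) := if i == k0 then x else (h k i).1.
pose G i (x : A) := if i == k0 then x else (h k i).2.
have uE z : opn o (u z) = (opn o (F^~ z.1), opn o (G^~ z.2)).
  by congr pair; congr opn; apply/funext => i; rewrite /u /F /G; case: eqP.
have FG i : twin r (F i) (G i).
  rewrite /F /G; case: (i == k0); first exact: twin_id.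
  by apply: twin_cst; rewrite /h; case: ifP.
have := pq k0 _ _ (twin_comp fg (twin_opn FG)).
by rewrite E1 E2 !uE.
Qed.

(** For a congruence [r] and equality as [dl] this is the annihilator. Only reflexivity of [r] is
    required, since [r] may also be the image of a congruence under a homomorphism, which can fail
    to be transitive. *)
Program Definition central A (r dl : A -> A -> Prop) (rr : forall x, r x x) :
    congruence A :=
  @Congruence S A (fun x y => linked r dl (x, x) (y, y)) _ _ _ _.
Next Obligation. by []. Qed.
Next Obligation. by move=> f g fg; apply: iff_sym; exact: H. Qed.
Next Obligation.
by move=> f g fg; apply: iff_trans (H _ _ fg) _; exact: H0.
Qed.
Next Obligation.
exact: (@linked_opn A r dl o (fun i => (x i, x i)) (fun i => (y i, y i))).
Qed.

(** During the induction the parameters are indexed by any finite type, so that an operation can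
    take the disjoint union of the index types of its arguments; enumeration yields an ordinal at
    the end. *)
Lemma twin_term A (r : A -> A -> Prop) f g : twin r f g ->
  exists n (t : term S ('I_1 + 'I_n)) (c d : 'I_n -> A),
    [/\ forall j, r (c j) (d j), forall x, f x = eval (env2 (fun=> x) c) t &
        forall x, g x = eval (env2 (fun=> x) d) t].
Proof.
move=> fg.
pose data := {X : finType & (term S ('I_1 + X) * (X -> A * A))%type}.
pose P (w : data) f g :=
  [/\ forall j, r ((tagged w).2 j).1 ((tagged w).2 j).2,
      forall x : A, f x = eval (env2 (fun=> x) (fst \o (tagged w).2)) (tagged w).1 &
      forall x : A, g x = eval (env2 (fun=> x) (snd \o (tagged w).2)) (tagged w).1].
suff [[X [t e]] [/= re fE gE]] : exists w, P w f g.
  pose s (v : 'I_1 + X) : term S ('I_1 + 'I_#|X|) :=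
    match v with inl i => Var (inl i) | inr j => Var (inr (enum_rank j)) end.
  exists #|X|, (subst s t), (fun j => (e (enum_val j)).1),
    (fun j => (e (enum_val j)).2); split=> // x.
    by rewrite fE eval_subst; apply: eval_ext => -[i|j] //=; rewrite enum_rankK.
  by rewrite gE eval_subst; apply: eval_ext => -[i|j] //=; rewrite enum_rankK.
elim: fg => {f g} [|c d cd|o F G _ /choice[w wP]].
- exists (existT _ (void : finType)
    (Var (inl ord0), fun v : void => match v with end) : data).
  by split=> // -[].
- by exists (existT _ (unit : finType) (Var (inr tt), fun=> (c, d)) : data).
pose X := {i : 'I_(arity o) & tag (w i)} : finType.
pose s i (v : 'I_1 + tag (w i)) : term S ('I_1 + X) :=
  match v with
  | inl k => Var (inl k)
  | inr j => Var (inr (Tagged (fun i => tag (w i) : Type) j))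
  end.
exists (existT _ (X : finType) (App o (fun i => subst (@s i) (tagged (w i)).1),
                    fun v : X => (tagged (w (tag v))).2 (tagged v)) : data).
split=> [v|x|x] /=; first by case: (wP (tag v)).
  congr opn; apply/funext => i; rewrite eval_subst.
  by have [_ -> _] := wP i; apply: eval_ext => -[].
congr opn; apply/funext => i; rewrite eval_subst.
by have [_ _ ->] := wP i; apply: eval_ext => -[].
Qed.

(** A twin is one term with a single moving variable, which gives one direction. For the other,
    linkage passes from the leaves of a term to the whole term by [linked_opn], and the identity
    twin reads off the claim. *)
Lemma centralizesP A (phi theta delta : congruence A) :
  centralizes phi theta delta <->
  forall x y, phi x y -> linked theta delta (x, x) (y, y).
Proof.
split=> [H x y xy f g /twin_term[n [t [c [d [cd fE gE]]]]] /=|H m n t a b c d ab cd].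
  rewrite !fE !gE; split; apply: H => // _; exact: con_sym.
have thetat (e : 'I_m -> A) :
    theta (eval (env2 e c) t) (eval (env2 e d) t).
  by apply: con_eval => -[i|j] //=; exact: con_refl.
suff H1 : linked theta delta (eval (env2 a c) t, eval (env2 a d) t)
                             (eval (env2 b c) t, eval (env2 b d) t).
  by have /= [] := H1 _ _ (twin_id _).
elim: t {thetat} => [[i|j]|o ts IH] /=; [exact: H|by []|].
apply: (@linked_opn A theta delta o
  (fun i => (eval (env2 a c) (ts i), eval (env2 a d) (ts i)))
  (fun i => (eval (env2 b c) (ts i), eval (env2 b d) (ts i)))) => // i /=.
  by apply: con_eval => -[k|j] //=; exact: con_refl.
by apply: con_eval => -[k|j] //=; exact: con_refl.
Qed.

Lemma annihilatorE A (theta : congruence A) x y :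
  annihilator theta x y <-> linked theta eq (x, x) (y, y).
Proof.
have [ann_central ann_max] := annihilatorP theta; split.
  by move: x y; exact/(centralizesP _ _ con0).
have := ann_max (central eq (con_refl theta)); apply.
exact/(centralizesP _ _ con0).
Qed.

Lemma abelianP A (theta : congruence A) :
  abelian theta <-> con_le theta (annihilator theta).
Proof.
apply: iff_trans (centralizesP _ _ _) _.
by split=> H x y /H; rewrite annihilatorE.
Qed.

End Twins.

(** * Nonzero congruences, monoliths and pullbacks *)

Section Congruences.
Variable S : signature.
Implicit Types A B : algebra S.

Lemma con_neq0 A (theta : congruence A) :
  theta <> con0 <-> exists x y, theta x y /\ x <> y.
Proof.
split=> [t0|[x [y [xy nxy]]] t0]; last by rewrite t0 in xy.
apply: contrapT => none; apply: t0; apply: con_ext => x y; split=> [xy|->].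
  by apply: contrapT => nxy; apply: none; exists x, y.
exact: con_refl.
Qed.

Lemma monolith_le A (theta : congruence A) x y :
  theta x y -> x <> y -> con_le (monolith A) theta.
Proof. by move=> xy nxy a b; apply; apply/con_neq0; exists x, y. Qed.

Program Definition con_pull A B (f : hom A B) (theta : congruence B) :
    congruence A :=
  @Congruence S A (fun x y => theta (f x) (f y)) _ _ _ _.
Next Obligation. exact: con_refl. Qed.
Next Obligation. exact: con_sym. Qed.
Next Obligation. by apply: con_trans; first exact: H. Qed.
Next Obligation. by rewrite !hom_is_hom; exact: con_opn. Qed.

End Congruences.

(** * The algebra A(theta) and its congruence Delta *)

Section DifferenceTheory.
Variables (S : signature) (A : algebra S) (theta : congruence A).
Variable d : term S 'I_3.
Hypothesis theta_abelian : abelian theta.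
Hypothesis d_maltsev : forall a b, theta a b ->
  eval3 d a a b = b /\ eval3 d b a a = b.

Local Notation E := (con_alg theta).
Local Notation D := (Delta theta (annihilator theta)).
Local Notation diag := (con_diag theta).

Definition con_fst : hom (con_alg theta) A :=
  @Hom S (con_alg theta) A (fun p => (sval p).1) (fun _ _ => erefl).
Definition con_snd : hom (con_alg theta) A :=
  @Hom S (con_alg theta) A (fun p => (sval p).2) (fun _ _ => erefl).
Definition con_pair a b (ab : theta a b) : con_alg theta :=
  exist _ (a, b) ab.

Lemma con_alg_ext (p q : con_alg theta) :
  con_fst p = con_fst q -> con_snd p = con_snd q -> p = q.
Proof.
by case: p q => -[a b] ab [[a' b'] ab'] /= ea eb; apply: eq_exist; rewrite ea eb.
Qed.

Lemma con_alg_rel (p : con_alg theta) : theta (con_fst p) (con_snd p).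
Proof. exact: svalP p. Qed.

(* The kernel of the natural map from A(theta) onto A / (0 : theta). *)
Definition block_con : congruence (con_alg theta) :=
  con_pull con_fst (annihilator theta).

Lemma d_left a b : theta a b -> eval3 d a a b = b.
Proof. by move/d_maltsev => []. Qed.

Lemma d_right a b : theta a b -> eval3 d b a a = b.
Proof. by move/d_maltsev => []. Qed.

Lemma d_idem (a : A) : eval3 d a a a = a.
Proof. by apply: d_left; exact: con_refl. Qed.

Lemma theta_ann a b : theta a b -> annihilator theta a b.
Proof. by move: a b; apply/abelianP. Qed.

Lemma Delta_diag a b : annihilator theta a b -> D (diag a) (diag b).
Proof. by move=> ab psi; apply; exists a, b. Qed.

(** Linkage by theta-twins is a congruence of A(theta), and it contains the generators of Delta
    because these come from annihilator pairs. *)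
Lemma Delta_linked p q : D p q -> linked theta eq (sval p) (sval q).
Proof.
have @L : congruence E.
  apply: (@Congruence S E (fun p q => linked theta eq (sval p) (sval q))) =>
    // [x y xy f g fg|x y z xy yz f g fg|o x y xy].
  - exact: iff_sym (xy _ _ fg).
  - exact: iff_trans (xy _ _ fg) (yz _ _ fg).
  - apply: (linked_opn _ _ xy) => i; exact: con_alg_rel.
by move=> /(_ L); apply=> _ _ [a [b [/annihilatorE ab -> ->]]].
Qed.

Lemma Delta_eq p q : D p q -> con_fst p = con_snd p <-> con_fst q = con_snd q.
Proof. by move/Delta_linked/(_ _ _ (twin_id _)). Qed.

Lemma Delta_block : con_le D block_con.
Proof. by move=> p q /(_ block_con); apply=> _ _ [a [b [ab -> ->]]]. Qed.

Lemma Delta_block_diag p q : block_con p q -> D (diag (con_fst p)) (diag (con_fst q)).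
Proof. exact: Delta_diag. Qed.

(* [rep1 p q] and [rep2 p q] represent the Delta-classes of [p] and [q] by
   pairs with the same first coordinate. *)
Definition rep1 (p q : con_alg theta) : con_alg theta :=
  eval3 d p (con_diag theta (con_fst p)) (con_diag theta (con_fst q)).
Definition rep2 (p q : con_alg theta) : con_alg theta :=
  eval3 d (con_diag theta (con_fst p)) (con_diag theta (con_fst p)) q.

Lemma rep_fst p q : con_fst (rep1 p q) = con_fst (rep2 p q).
Proof. by rewrite /rep1 /rep2 !eval3_hom. Qed.

(** With [a] the first coordinate of [p] one has [p = d(p, (a, a), (a, a))]; replacing the last
    argument by the diagonal pair of [q] stays in the Delta-class. *)
Lemma rep1P p q : block_con p q -> D p (rep1 p q).
Proof.
move=> pq; have {1}-> : p = eval3 d p (diag (con_fst p)) (diag (con_fst p)).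
  apply: con_alg_ext; rewrite eval3_hom /= ?d_idem //.
  by rewrite d_right //; exact: con_alg_rel.
by apply: con_eval3; [exact: con_refl..|exact: Delta_block_diag].
Qed.

Lemma rep2P p q : block_con p q -> D q (rep2 p q).
Proof.
move=> pq; have {1}-> : q = eval3 d (diag (con_fst q)) (diag (con_fst q)) q.
  apply: con_alg_ext; rewrite eval3_hom /= ?d_idem //.
  by rewrite d_left //; exact: con_alg_rel.
by apply: con_eval3; [apply: con_sym; exact: Delta_block_diag..|exact: con_refl].
Qed.

Lemma common_fst p q : block_con p q ->
  exists p' q', [/\ D p p', D q q' & con_fst p' = con_fst q'].
Proof.
move=> pq; exists (rep1 p q), (rep2 p q).
by split; [exact: rep1P|exact: rep2P|exact: rep_fst].
Qed.

(** For [p = (a, b)] and [q = (a, c)] the polynomial [d(x, p, (b, b))] sends [p] to [(b, b)] and [q]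
    to [(b, c)]. *)
Lemma con_shift (psi : congruence E) (p q : E) : psi p q -> con_fst p = con_fst q ->
  exists r : E, [/\ psi (diag (con_snd p)) r, con_fst r = con_snd p & con_snd r = con_snd q].
Proof.
move=> pq e; pose s := diag (con_snd p).
have E1 : eval3 d p p s = diag (con_snd p).
  apply: con_alg_ext; rewrite eval3_hom /= ?d_idem //.
  by rewrite d_left //; exact: con_alg_rel.
have sp : theta (con_snd p) (con_snd q).
  apply: con_trans (con_sym (con_alg_rel p)) _; rewrite [con_fst p]e.
  exact: con_alg_rel.
exists (eval3 d q p s); rewrite !eval3_hom /=; split.
- by rewrite -[X in psi X]E1; apply: con_eval3 => //; exact: con_refl.
- rewrite [(sval q).1](esym e) d_left //; exact: con_alg_rel.
- by rewrite d_right.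
Qed.

(** After [con_shift] the pair of the two second coordinates is Delta-related to a diagonal pair,
    hence is diagonal itself. *)
Lemma Delta_inj p q : D p q -> con_fst p = con_fst q -> p = q.
Proof.
move=> pq e; have [r [/Delta_eq[+ _] r1 r2]] := con_shift pq e.
by move=> /(_ erefl); rewrite r1 r2; exact: con_alg_ext.
Qed.

(** Modulo Delta, parameters and arguments can be given common first coordinates. There Delta is
    equality, and abelianness of [theta] settles the second coordinates. *)
Lemma block_abelian p q :
  block_con p q -> linked block_con D (p, p) (q, q).
Proof.
suff key f g p' q' : twin block_con f g -> block_con p' q' ->
    D (f p') (g p') -> D (f q') (g q').
  by move=> pq f g fg; split; apply: key => //; exact: con_sym.
(* First transfer: the parameters become Delta-equivalent ones whose first coordinates agree. *)
pose r (x y : E) := con_fst x = con_fst y.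
have r_refl x : r x x by [].
pose T0 (x' y' x y : E) := D x x' /\ D y y'.
case/(twin_transfer (rA := r) (T := T0)) => [o x y z w H|c e ce|f0 [g0 [fg0 H0]]].
- by split; apply: con_opn => i; case: (H i).
- by have [c' [e' [? ? ?]]] := common_fst ce; exists c', e'.
(* Second transfer: on second coordinates, parameters with a common first coordinate become
   theta-related. *)
pose T1 (x' y' : A) (x y : E) := [/\ con_fst x = con_fst y, con_snd x = x' & con_snd y = y'].
have [o x y z w H|c e ce|f1 [g1 [fg1 H1]]] :=
    @twin_transfer _ _ _ theta r T1 _ _ _ _ fg0.
- split.
  + by rewrite !hom_is_hom; congr opn; apply/funext => i; case: (H i).
  + by rewrite hom_is_hom; congr opn; apply/funext => i; case: (H i).
  + by rewrite hom_is_hom; congr opn; apply/funext => i; case: (H i).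
- exists (con_snd c), (con_snd e); split=> //.
  apply: con_trans (con_sym (con_alg_rel c)) _; rewrite [con_fst c]ce.
  exact: con_alg_rel.
move=> pq; have [p1 [q1 [pp1 qq1 e1]]] := common_fst pq => Dp.
have [Dfp Dgp] := H0 p1 p1 p' p' (conj pp1 pp1).
have [Dfq Dgq] := H0 q1 q1 q' q' (conj qq1 qq1).
have [ep1 ep2 ep3] := H1 (con_snd p1) (con_snd p1) p1 p1 (And3 erefl erefl erefl).
have [eq1 eq2 eq3] := H1 (con_snd q1) (con_snd q1) q1 q1 (And3 erefl erefl erefl).
have D1 : D (f0 p1) (g0 p1).
  by apply: con_trans (con_sym Dfp) _; apply: con_trans Dp Dgp.
have := Delta_inj D1 ep1 => /(congr1 con_snd); rewrite ep2 ep3 => efg.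
have sp : theta (con_snd p1) (con_snd q1).
  apply: con_trans (con_sym (con_alg_rel p1)) _; rewrite e1.
  exact: con_alg_rel.
have /annihilatorE/(_ _ _ fg1) /= [+ _] := theta_ann sp.
move=> /(_ efg) efg'.
apply: con_trans Dfq _; apply: con_trans (con_sym Dgq).
suff -> : f0 q1 = g0 q1 by exact: con_refl.
by apply: con_alg_ext => //; rewrite [con_snd _]eq2 [con_snd (g0 _)]eq3.
Qed.

Lemma block_not_Delta : theta <> con0 -> exists p q, block_con p q /\ ~ D p q.
Proof.
move=> /con_neq0[a [b [ab nab]]].
exists (diag a), (con_pair ab); split; first exact: con_refl.
by move=> /Delta_eq /= [+ _] => /(_ erefl).
Qed.

(** The parameter pairs of a theta-twin are elements of A(theta), so the twin acting coordinatewise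
    is one unary polynomial there. *)
Lemma twin_poly f g : twin theta f g ->
  exists h : E -> E, (forall p, sval (h p) = (f (con_fst p), g (con_snd p))) /\
    forall psi : congruence E, forall p q, psi p q -> psi (h p) (h q).
Proof.
move=> fg; pose T (p q : E) x y := p = q /\ sval p = (x, y).
have [o x y z w H|c e ce|h [k [hk H]]] :=
    @twin_transfer _ _ _ eq theta T _ _ _ _ fg.
- split; first by congr opn; apply/funext => i; case: (H i).
  by rewrite /=; congr pair; congr opn; apply/funext => i; case: (H i) => _ ->.
- by exists (con_pair ce), (con_pair ce).
have hP p := H p p (con_fst p) (con_snd p) (conj erefl (surjective_pairing _)).
exists h; split=> [p|psi p q pq]; first by case: (hP p).
have [-> _] := hP q.
by apply: (twin_con _ hk) => // x _ <-; exact: con_refl.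
Qed.

(** A nonzero congruence of A is extracted from [psi]; it contains [theta], so [psi] relates every
    pair to the diagonal pair of its first coordinate. With [block_not_Delta] this identifies the
    monolith of the difference algebra. *)
Lemma block_monolith (psi : congruence E) : is_monolith theta ->
  con_le D psi -> ~ con_le psi D -> con_le block_con psi.
Proof.
move=> [_ theta_min] Dpsi psiD.
have [u [v [uv e nuv]]] :
    exists u v : E, [/\ psi u v, con_fst u = con_fst v & con_snd u <> con_snd v].
  apply: contrapT => none; apply: psiD => p q pq; apply: contrapT => nD.
  have [apq|] := pselect (block_con p q).
    have [p' [q' [pp' qq' e]]] := common_fst apq.
    have [e'|ne] := pselect (con_snd p' = con_snd q').
      apply: nD; apply: con_trans pp' _.
      by rewrite (con_alg_ext e e'); exact: con_sym.
    apply: none; exists p', q'; split=> //.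
    by apply: con_trans (con_sym (Dpsi _ _ pp')) _;
       apply: con_trans pq (Dpsi _ _ qq').
  (* Outside [block_con] some twin [f], [g] separates the first coordinates. With [h] acting as
     [(f, g)] and [k] as [(f, f)], the two polynomials agree at one of the points, and their values
     at the other form the wanted pair. *)
  apply=> /=; apply/annihilatorE => f g fg /=.
  have [h [hE hpsi]] := twin_poly fg.
  have [k [kE kpsi]] := twin_poly (twin_diag (con_refl theta) fg).
  suff key p' q' : psi p' q' -> f (con_fst p') = g (con_fst p') ->
      f (con_fst q') = g (con_fst q').
    by split; apply: key => //; exact: con_sym.
  move=> pq' ep; apply: contrapT => nq; apply: none.
  have lk (x : E) : f (con_fst x) = g (con_fst x) <-> f (con_snd x) = g (con_snd x).
    by have /annihilatorE/(_ _ _ fg) := theta_ann (con_alg_rel x).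
  exists (h q'), (k q'); split; last first.
  - by rewrite /con_snd /= hE kE /= => e2; apply: nq; apply/lk.
  - by rewrite /con_fst /= hE kE.
  have hkp : h p' = k p'.
    apply: con_alg_ext; rewrite /= hE kE //=; exact/esym/lk.
  apply: con_trans (con_sym (hpsi _ _ _ pq')) _.
  by rewrite hkp; exact: kpsi.
have [w [uw w1 w2]] := con_shift uv e.
(* Here [a] and [b] are related when [psi] identifies [(a, a)] with [(a, b)]. *)
have @nu : congruence A.
  apply: (@Congruence S A
    (fun a b => exists p : E, sval p = (a, b) /\ psi (diag a) p)).
  - by move=> a; exists (diag a); split=> //; exact: con_refl.
  - move=> a b [p [pE ap]].
    have ab : theta a b by have := con_alg_rel p; rewrite /= pE.
    exists (con_pair (con_sym ab)); split=> //.
    (* The polynomial [d((b, b), x, (a, a))] sends [(a, a)] to [(b, b)] and [(a, b)] to [(b, a)]. *)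
    have -> : diag b = eval3 d (diag b) (diag a) (diag a).
      by apply: con_alg_ext; rewrite eval3_hom /= d_right.
    have -> : con_pair (con_sym ab) = eval3 d (diag b) p (diag a).
      apply: con_alg_ext; rewrite eval3_hom /= pE /=; first by rewrite d_right.
      by rewrite d_left //; exact: con_sym.
    by apply: con_eval3 => //; exact: con_refl.
  - move=> a b c [p [pE ap]] [q [qE bq]].
    have ab : theta a b by have := con_alg_rel p; rewrite /= pE.
    have bc : theta b c by have := con_alg_rel q; rewrite /= qE.
    have ac := con_trans ab bc.
    exists (con_pair ac); split=> //; apply: con_trans ap _.
    (* The polynomial [d((a, b), (b, b), x)] sends [(b, b)] to [(a, b)] and [(b, c)] to [(a, c)]. *)
    have -> : p = eval3 d p (diag b) (diag b).
      apply: con_alg_ext; rewrite eval3_hom /= pE /= ?d_idem //.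
      by rewrite d_right //; exact: con_sym.
    have -> : con_pair ac = eval3 d p (diag b) q.
      apply: con_alg_ext; rewrite eval3_hom /= pE qE /=; last by rewrite d_left.
      by rewrite d_right //; exact: con_sym.
    by apply: con_eval3 => //; exact: con_refl.
  - move=> o x y /choice[p pP].
    exists (opn o p); split.
      by rewrite /=; congr pair; congr opn; apply/funext => i;
         case: (pP i) => ->.
    have -> : diag (opn o x) = opn o (fun i => diag (x i)) by exact: con_alg_ext.
    by apply: con_opn => i; case: (pP i).
have nu_theta : con_le theta nu.
  apply: theta_min; apply/con_neq0; exists (con_snd u), (con_snd v); split=> //.
  by exists w; split=> //; rewrite [sval w]surjective_pairing -w1 -w2.
have psi_diag p : psi (diag (con_fst p)) p.
  have [q [qE]] := nu_theta _ _ (con_alg_rel p).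
  suff -> : q = p by [].
  by apply: con_alg_ext; rewrite /= qE.
move=> p q pq; apply: con_trans (con_sym (psi_diag p)) _.
apply: con_trans (psi_diag q); apply: Dpsi; exact: Delta_block_diag.
Qed.

Lemma con_val_eval3 (t : term S 'I_3) (p q r : con_alg theta) :
  sval (eval3 t p q r) = eval3 t (sval p : prod_alg A A) (sval q) (sval r).
Proof. exact: (eval3_hom (@Hom S E (prod_alg A A) sval (fun _ _ => erefl))). Qed.

End DifferenceTheory.
Arguments con_fst {S A theta}.
Arguments con_snd {S A theta}.

(** * Isomorphisms obtained from compatible relations *)

Section Isomorphisms.
Variable S : signature.
Implicit Types A B : algebra S.

Definition compatible A B (H : A -> B -> Prop) :=
  forall o x y, (forall i, H (x i) (y i)) -> H (opn o x) (opn o y).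

Lemma iso_of_rel A B (H : A -> B -> Prop) : compatible H ->
  (forall a, exists b, H a b) -> (forall b, exists a, H a b) ->
  (forall a b a' b', H a b -> H a' b' -> a = a' <-> b = b') ->
  isomorphic A B.
Proof.
move=> Hopn /choice[f Hf] /choice[g Hg] Heq.
have f_hom : is_hom f.
  move=> o x.
  have H1 : H (opn o x) (opn o (f \o x)) by apply: Hopn => i; exact: Hf.
  by have [->] := Heq _ _ _ _ (Hf (opn o x)) H1.
exists (Hom f_hom), g => x /=.
  by have [_ ->] := Heq _ _ _ _ (Hg (f x)) (Hf x).
by have [->] := Heq _ _ _ _ (Hf (g x)) (Hg x).
Qed.

Lemma quot_iso A B (theta : congruence A) (eta : congruence B)
    (H : A -> B -> Prop) : compatible H ->
  (forall a, exists b, H a b) -> (forall b, exists a, H a b) ->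
  (forall a b a' b', H a b -> H a' b' -> theta a a' <-> eta b b') ->
  isomorphic (quot_alg theta) (quot_alg eta).
Proof.
move=> Hopn Hl Hr Heq; apply: (@iso_of_rel (quot_alg theta) (quot_alg eta)
  (fun X Y => exists a b,
     [/\ X = quot_class theta a, Y = quot_class eta b & H a b])).
- move=> o x y /choice[a /choice[b ab]].
  exists (opn o a), (opn o b); split.
  + by rewrite quot_class_hom; congr opn; apply/funext => i; case: (ab i).
  + by rewrite quot_class_hom; congr opn; apply/funext => i; case: (ab i).
  + by apply: Hopn => i; case: (ab i).
- move=> X; have [b ?] := Hl (quot_repr X).
  by exists (quot_class eta b), (quot_repr X), b; split; rewrite ?quot_reprK.
- move=> Y; have [a ?] := Hr (quot_repr Y).
  by exists (quot_class theta a), a, (quot_repr Y); split; rewrite ?quot_reprK.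
move=> _ _ _ _ [a [b [-> -> ab]]] [a' [b' [-> -> ab']]].
by rewrite !quot_classP; exact: Heq.
Qed.

Lemma isomorphic_sym A B : isomorphic A B -> isomorphic B A.
Proof.
case=> f [g fK gK].
have g_hom : is_hom g.
  move=> o x; apply: (can_inj fK); rewrite gK hom_is_hom.
  by congr opn; apply/funext => i; rewrite gK.
by exists (Hom g_hom), f.
Qed.

Lemma iso_con_ker A B C (f1 : hom C A) (f2 : hom C B) : onto f1 -> onto f2 ->
  (forall x y, f1 x = f1 y <-> f2 x = f2 y) -> isomorphic A B.
Proof.
move=> on1 on2 ker12.
apply: (@iso_of_rel A B (fun a b => exists x, f1 x = a /\ f2 x = b)).
- move=> o a b /choice[x xP]; exists (opn o x).
  by rewrite !hom_is_hom; split; congr opn; apply/funext => i; case: (xP i).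
- by move=> a; have [x <-] := on1 a; exists (f2 x), x.
- by move=> b; have [x <-] := on2 b; exists (f1 x), x.
- by move=> _ _ _ _ [x [<- <-]] [y [<- <-]].
Qed.

End Isomorphisms.

(** * Transfer of linkage along bridges *)

Section Bridges.
Variable S : signature.
Implicit Types A B : algebra S.

(** Twins over [rB] become twins over [rA], and equality of their values passes through [T]. The
    relations are arbitrary because, besides monoliths, images of a congruence are used. *)
Lemma bridge_linked A B (rA : A -> A -> Prop) (rB : B -> B -> Prop)
    (T : subuniverse (prod_alg (prod_alg A A) (prod_alg B B))) :
  (forall c d, rB c d -> exists c' d', rA c' d' /\ T ((c', d'), (c, d))) ->
  (forall a1 a2 b1 b2, T ((a1, a2), (b1, b2)) -> (a1 = a2 <-> b1 = b2)) ->
  forall a b a' b', T ((a, a), (b, b)) -> T ((a', a'), (b', b')) ->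
  linked rA eq (a, a) (a', a') -> linked rB eq (b, b) (b', b').
Proof.
move=> Tr Teq a b a' b' Tab Tab' lk f g fg.
have [o x y z w xyzw|f' [g' [fg' H]]] := @twin_transfer _ A B rA rB
    (fun x y z w => T ((x, y), (z, w))) _ Tr _ _ fg.
  exact: (subu_closed (s := T) xyzw).
have := Teq _ _ _ _ (H _ _ _ _ Tab); have := Teq _ _ _ _ (H _ _ _ _ Tab').
by have /= := lk _ _ fg'; tauto.
Qed.

Program Definition bridge_swap A B
    (T : subuniverse (prod_alg (prod_alg A A) (prod_alg B B))) :
    subuniverse (prod_alg (prod_alg B B) (prod_alg A A)) :=
  @Subuniverse S (prod_alg (prod_alg B B) (prod_alg A A))
    (fun p => T (p.2, p.1)) _.
Next Obligation. exact: (subu_closed (s := T) H). Qed.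

Lemma bridge_swapP A B
    (T : subuniverse (prod_alg (prod_alg A A) (prod_alg B B))) :
  similarity_bridge T -> similarity_bridge (bridge_swap T).
Proof.
case=> b1 b2 b3 b4; split=> //= [x y z w /b3 ->|x y z w /b4] //.
Qed.

Lemma iso_bridge A B : subdirectly_irreducible A -> isomorphic A B ->
  exists T : subuniverse (prod_alg (prod_alg A A) (prod_alg B B)),
    similarity_bridge T.
Proof.
move=> siA [f [g fK gK]].
have fI := can_inj fK.
have g_hom : is_hom g.
  move=> o x; apply: fI; rewrite gK hom_is_hom.
  by congr opn; apply/funext => i; rewrite gK.
have mono x y : monolith B (f x) (f y) <-> monolith A x y.
  split=> [H|H theta /con_neq0[b [b' [bb' nb]]]].
    move=> theta /con_neq0[a [a' [aa' na]]].
    have := monolith_le (theta := con_pull (Hom g_hom) theta)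
      (x := f a) (y := f a') _ _ H; rewrite /= !fK; apply=> //.
    by move=> /fI.
  have := monolith_le (theta := con_pull f theta) (x := g b) (y := g b') _ _ H.
  by rewrite /= !gK; apply=> // /(congr1 f); rewrite !gK.
pose P (p : prod_alg (prod_alg A A) (prod_alg B B)) :=
  [/\ monolith A p.1.1 p.1.2, p.2.1 = f p.1.1 & p.2.2 = f p.1.2].
have Pcl o x : (forall i, P (x i)) -> P (@opn _ _ o x).
  move=> H; split=> /=.
  - by apply: (con_opn (c := monolith A)) => i; case: (H i).
  - by rewrite hom_is_hom; congr opn; apply/funext => i; case: (H i).
  - by rewrite hom_is_hom; congr opn; apply/funext => i; case: (H i).
exists (Subuniverse Pcl); split; rewrite /= /P.
- by move=> a1 a2; split=> [[b1 [b2 []]]|H] //; exists (f a1), (f a2).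
- move=> b1 b2; split=> [[a1 [a2 [/= H -> ->]]]|H]; first exact/mono.
  by exists (g b1), (g b2); rewrite !gK; split=> //; apply/mono; rewrite !gK.
- by move=> a1 a2 b1 b2 [/= _ -> ->]; split=> [->|/fI].
- move=> a1 a2 b1 b2 [/= _ -> ->].
  by split; split=> //; exact: (con_refl (monolith A)).
Qed.

End Bridges.

(** * Bridges and annihilators; the nonabelian case *)

Section BridgeTheory.
Variables (S : signature) (A B : algebra S).
Variable T : subuniverse (prod_alg (prod_alg A A) (prod_alg B B)).
Hypothesis br : similarity_bridge T.

Lemma bridge_ann a b a' b' :
  T ((a, a), (b, b)) -> T ((a', a'), (b', b')) ->
  annihilator (monolith A) a a' -> annihilator (monolith B) b b'.
Proof.
move=> Tab Tab' /annihilatorE H; apply/annihilatorE.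
apply: bridge_linked Tab Tab' H; last exact: bridge_eq br.
move=> c d /(bridge_snd br)[c' [d' Tc]]; exists c', d'; split=> //.
by apply/(bridge_fst br); exists c, d.
Qed.

Lemma bridge_abelian : abelian (monolith A) -> abelian (monolith B).
Proof.
move=> /abelianP abA; apply/abelianP => b b' /(bridge_snd br)[a [a' Tab]].
have [? ?] := bridge_diag br Tab; apply: (bridge_ann (a := a) (a' := a')) => //.
by apply: abA; apply/(bridge_fst br); exists b, b'.
Qed.

(** Two partners of one element are congruent modulo the annihilator; if distinct, they would force
    the annihilator to contain the monolith. *)
Lemma bridge_functional a b b' : ~ abelian (monolith B) ->
  T ((a, a), (b, b)) -> T ((a, a), (b', b')) -> b = b'.
Proof.
move=> nab Tb Tb'; apply: contrapT => nb; apply: nab; apply/abelianP.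
apply: monolith_le nb; apply: bridge_ann Tb Tb' _; exact: con_refl.
Qed.

Lemma bridge_total a : exists b, T ((a, a), (b, b)).
Proof.
have /(bridge_fst br)[b [b' Tab]] := con_refl (monolith A) a.
by exists b; case: (bridge_diag br Tab).
Qed.

End BridgeTheory.

Section BridgeIso.
Variables (S : signature) (A B : algebra S).
Variable T : subuniverse (prod_alg (prod_alg A A) (prod_alg B B)).
Hypothesis br : similarity_bridge T.

Lemma bridge_abelianE : abelian (monolith A) <-> abelian (monolith B).
Proof.
by split; [exact: bridge_abelian br|exact: bridge_abelian (bridge_swapP br)].
Qed.

Lemma bridge_nonabelian_iso : ~ abelian (monolith A) -> isomorphic A B.
Proof.
move=> nA; have nB : ~ abelian (monolith B) by rewrite -bridge_abelianE.
apply: (@iso_of_rel S A B (fun a b => T ((a, a), (b, b)))).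
- by move=> o x y H; exact: (subu_closed (s := T) H).
- exact: bridge_total br.
- exact: (bridge_total (bridge_swapP br)).
move=> a b a' b' Tab Tab'; split=> [e|e].
  by subst a'; exact: bridge_functional br _ _ _ nB Tab Tab'.
subst b'; exact: (bridge_functional (bridge_swapP br) nA Tab Tab').
Qed.

End BridgeIso.

(** * Bridges between abelian monoliths *)

Section AbelianBridge.
Variables (S : signature) (A B : algebra S).
Variable T : subuniverse (prod_alg (prod_alg A A) (prod_alg B B)).
Hypothesis br : similarity_bridge T.
Variable d : term S 'I_3.
Hypothesis dA : forall a b, monolith A a b ->
  eval3 d a a b = b /\ eval3 d b a a = b.
Hypothesis dB : forall a b, monolith B a b ->
  eval3 d a a b = b /\ eval3 d b a a = b.

Let mono a1 a2 b1 b2 : T ((a1, a2), (b1, b2)) ->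
  monolith A a1 a2 /\ monolith B b1 b2.
Proof.
move=> Tab; split; first by apply/(bridge_fst br); exists b1, b2.
by apply/(bridge_snd br); exists a1, a2.
Qed.

(** Apply [d] to the two quadruples with the diagonal quadruple of the middle point between them. *)
Lemma bridge_maltsev_trans a1 a2 a3 b1 b2 b3 : T ((a1, a2), (b1, b2)) ->
  T ((a2, a3), (b2, b3)) -> T ((a1, a3), (b1, b3)).
Proof.
move=> T12 T23; have [_ T22] := bridge_diag br T12.
have := subu_eval3 d T12 T22 T23; rewrite !eval3_prod /=.
have [/con_sym/dA[_ ->] /con_sym/dB[_ ->]] := mono T12.
by have [/dA[-> _] /dB[-> _]] := mono T23.
Qed.

Lemma bridge_maltsev_sym a1 a2 b1 b2 : T ((a1, a2), (b1, b2)) ->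
  T ((a2, a1), (b2, b1)).
Proof.
move=> T12; have [T11 T22] := bridge_diag br T12.
have := subu_eval3 d T11 T12 T22; rewrite !eval3_prod /=.
have [m1 m2] := mono T12.
have [-> _] := dA m1; have [-> _] := dB m2.
by have [_ ->] := dA (con_sym m1); have [_ ->] := dB (con_sym m2).
Qed.

(** Reversing one quadruple and composing it with the other gives a quadruple beginning with
    [a2, a2]. *)
Lemma bridge_inj a1 a2 b1 b2 b2' :
  T ((a1, a2), (b1, b2)) -> T ((a1, a2), (b1, b2')) -> b2 = b2'.
Proof.
move=> /bridge_maltsev_sym T1 T2.
by apply/(bridge_eq br (bridge_maltsev_trans T1 T2)).
Qed.

(** The representatives with common first coordinates are built by the same term on both sides, so
    [T] relates them. They coincide over A by [Delta_inj], then over B by [bridge_inj]. *)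
Lemma bridge_Delta (p p' : con_alg (monolith A))
    (q q' : con_alg (monolith B)) :
  T (sval p, sval q) -> T (sval p', sval q') ->
  Delta (monolith A) (annihilator (monolith A)) p p' ->
  Delta (monolith B) (annihilator (monolith B)) q q'.
Proof.
move=> Tpq Tpq' pp'.
have Tdiag (u : con_alg (monolith A)) (v : con_alg (monolith B)) :
    T (sval u, sval v) ->
    T (sval (con_diag (monolith A) (con_fst u)),
       sval (con_diag (monolith B) (con_fst v))).
  by case: u v => -[u1 u2] ? [[v1 v2] ?] /(bridge_diag br)[].
have ann_p := Delta_block pp'.
have ann_q : block_con (monolith B) q q'.
  exact: (@bridge_ann _ _ _ _ br (con_fst p) (con_fst q) (con_fst p')
    (con_fst q') (Tdiag _ _ Tpq) (Tdiag _ _ Tpq') ann_p).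
have Trep1 : T (sval (rep1 d p p'), sval (rep1 d q q')).
  have := subu_eval3 d Tpq (Tdiag _ _ Tpq) (Tdiag _ _ Tpq').
  by rewrite eval3_prod /rep1 /rep2 !con_val_eval3.
have Trep2 : T (sval (rep2 d p p'), sval (rep2 d q q')).
  have := subu_eval3 d (Tdiag _ _ Tpq) (Tdiag _ _ Tpq) Tpq'.
  by rewrite eval3_prod /rep1 /rep2 !con_val_eval3.
have Drep : Delta (monolith A) (annihilator (monolith A)) (rep1 d p p') (rep2 d p p').
  apply: con_trans (con_sym (rep1P dA ann_p)) _.
  exact: con_trans pp' (rep2P dA ann_p).
have Erep := Delta_inj dA Drep (rep_fst d p p').
apply: con_trans (rep1P dB ann_q) _.
apply: con_trans (con_sym (rep2P dB ann_q)).
suff -> : rep1 d q q' = rep2 d q q' by exact: con_refl.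
apply: con_alg_ext; first exact: rep_fst.
move: Trep1 Trep2 (rep_fst d q q'); rewrite Erep.
case: (rep2 d p p') (rep1 d q q') (rep2 d q q') => -[? ?] ? [[? ?] ?] [[? ?] ?].
by move=> /= T1 T2 e; subst; exact: bridge_inj T1 T2.
Qed.

End AbelianBridge.

(** * Isomorphisms of quotients as relations, and covers of kernels *)

Section QuotientRelations.
Variable S : signature.
Implicit Types A B : algebra S.

(* [H] is the graph of an isomorphism from A / theta to B / eta. *)
Definition quot_graph A B (theta : congruence A) (eta : congruence B)
    (H : A -> B -> Prop) :=
  [/\ compatible H, forall a, exists b, H a b, forall b, exists a, H a b &
    forall a b a' b', H a b ->
      (H a' b' -> (theta a a' <-> eta b b')) /\
      (theta a a' -> eta b b' -> H a' b')].

Lemma iso_graph A B (eta : congruence B) : isomorphic A (quot_alg eta) ->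
  exists H, quot_graph (con0 : congruence A) eta H.
Proof.
case=> f [g fK gK]; exists (fun a b => f a = quot_class eta b); split.
- move=> o x y xy; rewrite hom_is_hom quot_class_hom.
  by congr opn; apply/funext.
- by move=> a; exists (quot_repr (f a)); rewrite quot_reprK.
- by move=> b; exists (g (quot_class eta b)).
move=> a b a' b' ab; split=> [ab'|<- /quot_classP <-] //=.
rewrite -quot_classP -ab -ab'; split=> [->|] //; exact: (can_inj fK).
Qed.

Lemma quot_iso_graph A B (theta : congruence A) (eta : congruence B) :
  isomorphic (quot_alg theta) (quot_alg eta) ->
  exists H, quot_graph theta eta H.
Proof.
case/iso_graph=> H [Hopn Hl Hr Heq].
exists (fun a b => H (quot_class theta a) b); split.
- by move=> o x y xy; rewrite quot_class_hom; exact: Hopn.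
- by move=> a; exact: Hl.
- by move=> b; have [X] := Hr b; exists (quot_repr X); rewrite quot_reprK.
move=> a b a' b' /(Heq _ _ (quot_class theta a') b')[H1 H2].
by rewrite -(quot_classP theta); split.
Qed.

Lemma quot_graph_flip A B (theta : congruence A) (eta : congruence B) H :
  quot_graph theta eta H -> quot_graph eta theta (fun b a => H a b).
Proof.
case=> Hopn Hl Hr Heq; split=> //; first by move=> o x y; exact: Hopn.
move=> b a b' a' /(Heq _ _ a' b')[H1 H2]; split=> [/H1 ->//|? ?].
exact: H2.
Qed.

(** Transitivity is where all partners of one element must be [nu]-related. *)
Lemma con_preim A B (H : A -> B -> Prop) (nu : congruence B) :
  compatible H -> (forall a, exists b, H a b) ->
  (forall a b b', H a b -> H a b' -> nu b b') ->
  exists psi : congruence A, forall a a',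
    psi a a' <-> exists b b', [/\ H a b, H a' b' & nu b b'].
Proof.
move=> Hopn Hl Hnu.
unshelve eexists (@Congruence S A
  (fun a a' => exists b b', [/\ H a b, H a' b' & nu b b']) _ _ _ _) => //.
- by move=> a; have [b ab] := Hl a; exists b, b; split=> //; exact: con_refl.
- move=> a a' [b [b' [ab ab' bb']]]; exists b', b; split=> //.
  exact: con_sym.
- move=> a a1 a2 [b [b1 [ab ab1 bb1]]] [b1' [b2 [ab1' ab2 bb2]]].
  exists b, b2; split=> //; apply: con_trans bb1 _; apply: con_trans bb2.
  exact: Hnu ab1 ab1'.
- move=> o x y /choice[u /choice[v uv]]; exists (opn o u), (opn o v).
  by split; [apply: Hopn|apply: Hopn|apply: con_opn] => i; case: (uv i).
Qed.

(** A congruence above the kernel is the pullback of one of A, found by [con_preim] along the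
    converse of the graph of [f]; a nonzero congruence of A contains the monolith. *)
Lemma ker_cover A C (f : hom C A) : subdirectly_irreducible A -> onto f ->
  unique_upper_cover (con_ker f) (con_pull f (monolith A)).
Proof.
move=> siA onf; have [/con_neq0[a [a' [aa' na]]] _] := monolithP siA.
have above psi : con_le (con_ker f) psi -> psi <> con_ker f ->
    con_le (con_pull f (monolith A)) psi.
  move=> kpsi npsi; pose H a x := f x = a.
  have [||phi phiE] := @con_preim A C H psi _ onf.
  - by move=> o x y xy; rewrite /H hom_is_hom; congr opn; apply/funext.
  - by move=> b x x' <- /esym; exact: kpsi.
  have phipsi x y : phi (f x) (f y) <-> psi x y.
    split=> [/phiE[x' [y' [xx' yy' xy']]]|xy]; last first.
      by apply/phiE; exists x, y.
    apply: con_trans (kpsi _ _ (esym xx')) _.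
    exact: con_trans xy' (kpsi _ _ yy').
  have [x [y [xy nxy]]] : exists x y, psi x y /\ f x <> f y.
    apply: contrapT => none; apply: npsi; apply: con_ext => x y; split.
      by move=> xy; apply: contrapT => nxy; apply: none; exists x, y.
    exact: kpsi.
  move=> u v uv; apply/phipsi.
  by apply: (monolith_le (x := f x) (y := f y) _ _ uv) => //; apply/phipsi.
have lt : con_lt (con_ker f) (con_pull f (monolith A)).
  split=> [x y /= ->|E]; first exact: (con_refl (monolith A)).
  have [[x fx] [y fy]] := (onf a, onf a'); subst a a'.
  by apply: na; change (con_ker f x y); rewrite E.
split; first split=> // psi kpsi psip.
  have [->|/above psi'] := pselect (psi = con_ker f); first by left.
  by right; apply: con_ext => x y; split; [exact: psip|exact: psi'].
move=> psi [[kpsi npsi] cov].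
by have [E|<-//] := cov _ lt.1 (above _ kpsi (nesym npsi)); case: lt.2.
Qed.

End QuotientRelations.

(** * Varieties with a weak difference term: from bridges to similarity *)

Section WeakDifferenceTerm.
Variables (S : signature) (V : algebra S -> Prop).
Hypothesis V_variety : variety V.
Variable d : term S 'I_3.
Hypothesis wdt : weak_difference_term V d.
Implicit Types A B : algebra S.

Lemma wdt_maltsev A : V A -> abelian (monolith A) -> forall a b, monolith A a b ->
  eval3 d a a b = b /\ eval3 d b a a = b.
Proof.
move=> /wdt[_ H] /H{}H a b /H[|/= -> <-] // x _ <-; exact: (con_refl (monolith A)).
Qed.

Lemma variety_prod A B : V A -> V B -> V (prod_alg A B).
Proof.
move=> VA VB; pose F (b : bool) := if b then A else B.
have VF : V (big_prod_alg F) by apply: (variety_P V_variety) => -[].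
pose f (x : big_prod_alg F) : prod_alg A B := (x true, x false).
apply: (variety_H V_variety (f := @Hom S _ _ f (fun _ _ => erefl))) VF.
by move=> [a b]; exists (fun i : bool => if i return F i then a else b).
Qed.

(** For abelian monoliths [T], read as a relation between A(mu) and B(kappa), induces the
    isomorphism of the quotients. *)
Lemma bridge_similar A B (T : subuniverse (prod_alg (prod_alg A A) (prod_alg B B))) :
  V A -> V B -> similarity_bridge T -> similar A B.
Proof.
move=> VA VB br; have abE := bridge_abelianE br.
rewrite /similar /difference_algebra.
case: pselect => [abA|nA]; case: pselect => [abB|nB].
- have [dA dB] := (wdt_maltsev VA abA, wdt_maltsev VB abB).
  apply: (@quot_iso S (con_alg (monolith A)) (con_alg (monolith B)) _ _
    (fun p q => T (sval p, sval q))).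
  + by move=> o x y xy; exact: (subu_closed (s := T) xy).
  + move=> [[a a'] aa']; have [b [b' Tb]] := (bridge_fst br _ _).2 aa'.
    have bb' : monolith B b b' by apply/(bridge_snd br); exists a, a'.
    by exists (con_pair bb').
  + move=> [[b b'] bb']; have [a [a' Ta]] := (bridge_snd br _ _).2 bb'.
    have aa' : monolith A a a' by apply/(bridge_fst br); exists b, b'.
    by exists (con_pair aa').
  move=> p q p' q' Tpq Tpq'; split; first exact: (bridge_Delta br dA dB).
  exact: (@bridge_Delta _ _ _ _ (bridge_swapP br) d dB dA).
- by case: nB; apply/abE.
- by case: nA; apply/abE.
- exact: (bridge_nonabelian_iso br).
Qed.

(** * From similarity to bridges *)

Section Similar.
Variables A B : algebra S.
Hypotheses (siA : subdirectly_irreducible A) (siB : subdirectly_irreducible B).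

(** The pullback of [block_con] of B along [H] lies above Delta and not within it, so
    [block_monolith] applies to it. *)
Lemma graph_block (H : con_alg (monolith A) -> con_alg (monolith B) -> Prop)
    (abA : abelian (monolith A)) (abB : abelian (monolith B))
    (dA : forall a b, monolith A a b -> eval3 d a a b = b /\ eval3 d b a a = b) :
  quot_graph (Delta (monolith A) (annihilator (monolith A)))
             (Delta (monolith B) (annihilator (monolith B))) H ->
  forall p q p' q', H p q -> H p' q' ->
    block_con (monolith A) p p' -> block_con (monolith B) q q'.
Proof.
move=> [Hopn Hl Hr Heq].
have [|psi psiE] := con_preim Hopn Hl (nu := block_con (monolith B)).
  move=> p q q' pq pq'; apply: Delta_block.
  by apply/((Heq _ _ _ _ pq).1 pq'); exact: con_refl.
have psi_block : con_le (block_con (monolith A)) psi.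
  apply: (block_monolith abA dA (monolithP siA)).
    move=> p p' pp'; have [[q pq] [q' pq']] := (Hl p, Hl p').
    apply/psiE; exists q, q'; split=> //.
    by apply: Delta_block; apply/((Heq _ _ _ _ pq).1 pq').
  have [q [q' [qq' nqq']]] := block_not_Delta (monolithP siB).1.
  have [[p pq] [p' pq']] := (Hr q, Hr q').
  move=> /(_ p p') le; apply: nqq'; apply/((Heq _ _ _ _ pq).1 pq'); apply: le.
  by apply/psiE; exists q, q'.
have sat p q q' : H p q -> H p q' -> block_con (monolith B) q q'.
  move=> pq pq'; apply: Delta_block; apply/((Heq _ _ _ _ pq).1 pq').
  exact: con_refl.
move=> p q p' q' pq pq' /psi_block/psiE[q1 [q1' [pq1 pq1' qq1]]].
apply: con_trans (sat _ _ _ pq pq1) _; apply: con_trans qq1 _.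
exact: sat pq1' pq'.
Qed.

(* Related pairs (a, a1), (a, a2) correspond to pairs (b, b1), (b, b2) that can
   be chosen with a common first coordinate, although the isomorphism need not
   preserve the diagonal. *)
Lemma graph_bridge (H : con_alg (monolith A) -> con_alg (monolith B) -> Prop)
    (abA : abelian (monolith A)) (abB : abelian (monolith B))
    (dA : forall a b, monolith A a b -> eval3 d a a b = b /\ eval3 d b a a = b)
    (dB : forall a b, monolith B a b -> eval3 d a a b = b /\ eval3 d b a a = b) :
  quot_graph (Delta (monolith A) (annihilator (monolith A)))
             (Delta (monolith B) (annihilator (monolith B))) H ->
  forall a1 a2, monolith A a1 a2 -> exists u u' v v',
    [/\ H u v, H u' v', con_fst u = con_fst u', con_fst v = con_fst v' &
        con_snd u = a1 /\ con_snd u' = a2].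
Proof.
move=> HH a1 a2 a12; have [_ Hl _ Heq] := HH.
pose u := con_diag (monolith A) a1; pose u' := con_pair a12.
have [[v0 uv0] [v0' uv0']] := (Hl u, Hl u').
have uu' : block_con (monolith A) u u' by exact: con_refl.
have [v [v' [Dv Dv' vv']]] := common_fst dB (graph_block abA abB dA HH uv0 uv0' uu').
exists u, u', v, v'; split=> //.
  by apply: (Heq _ _ _ _ uv0).2 Dv; exact: con_refl.
by apply: (Heq _ _ _ _ uv0').2 Dv'; exact: con_refl.
Qed.

End Similar.

Section SimilarBridge.
Variables A B : algebra S.
Hypotheses (VA : V A) (VB : V B).
Hypotheses (siA : subdirectly_irreducible A) (siB : subdirectly_irreducible B).

(** This excludes the mixed case. The pullback of [block_con] to A contains the monolith of A, and
    [block_abelian] is carried back along [H]. *)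
Lemma iso_difference_abelian :
  isomorphic A (difference_algebra_at (monolith B)) ->
  abelian (monolith B) -> abelian (monolith A).
Proof.
move=> /iso_graph[H [Hopn Hl Hr Heq]] abB; have dB := wdt_maltsev VB abB.
have [|nu nuE] := con_preim Hopn Hl (nu := block_con (monolith B)).
  by move=> a q q' aq aq'; apply: Delta_block; apply/((Heq _ _ _ _ aq).1 aq').
have mu_nu : con_le (monolith A) nu.
  have [q [q' [qq' nqq']]] := block_not_Delta (monolithP siB).1.
  have [[a aq] [a' aq']] := (Hr q, Hr q').
  apply: (monolith_le (x := a) (y := a')); first by apply/nuE; exists q, q'.
  by move=> aa'; apply: nqq'; apply/((Heq _ _ _ _ aq).1 aq').
apply/abelianP => a a' /mu_nu/nuE[q [q' [aq aq' qq']]].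
apply/annihilatorE => f g fg /=.
have [o x y z w xy|c e /nuE[u [v [cu ev uv]]]|f' [g' [fg' H']]] :=
  @twin_transfer _ _ _ (block_con (monolith B)) nu
    (fun x' y' x y => H x x' /\ H y y') _ _ _ _ (twin_mono mu_nu fg).
- by split; apply: Hopn => i; case: (xy i).
- by exists u, v.
have [Hf Hg] := H' _ _ _ _ (conj aq aq).
have [Hf' Hg'] := H' _ _ _ _ (conj aq' aq').
have /= -> := (Heq _ _ _ _ Hf).1 Hg; have /= -> := (Heq _ _ _ _ Hf').1 Hg'.
exact: (block_abelian abB dB qq' fg').
Qed.

Lemma abelian_similar_bridge :
  abelian (monolith A) -> abelian (monolith B) ->
  isomorphic (difference_algebra_at (monolith A))
             (difference_algebra_at (monolith B)) ->
  exists T : subuniverse (prod_alg (prod_alg A A) (prod_alg B B)),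
    similarity_bridge T.
Proof.
move=> abA abB /quot_iso_graph[H HH].
have [dA dB] := (wdt_maltsev VA abA, wdt_maltsev VB abB).
(* Second coordinates are collected from [H]-related elements whose first coordinates agree on each
   side. *)
pose P (p : prod_alg (prod_alg A A) (prod_alg B B)) := exists u u' v v',
  [/\ H u v, H u' v', con_fst u = con_fst u', con_fst v = con_fst v' &
      p = ((con_snd u, con_snd u'), (con_snd v, con_snd v'))].
have [Hopn _ _ Heq] := HH.
have Pcl o x : (forall i, P (x i)) -> P (@opn _ _ o x).
  move=> /choice[u /choice[u' /choice[v /choice[v' uv]]]].
  exists (opn o u), (opn o u'), (opn o v), (opn o v'); split.
  - by apply: Hopn => i; case: (uv i).
  - by apply: Hopn => i; case: (uv i).
  - by rewrite !hom_is_hom; congr opn; apply/funext => i; case: (uv i).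
  - by rewrite !hom_is_hom; congr opn; apply/funext => i; case: (uv i).
  - have -> : x = fun i => ((con_snd (u i), con_snd (u' i)),
                            (con_snd (v i), con_snd (v' i))).
      by apply/funext => i; case: (uv i).
    by [].
exists (Subuniverse Pcl); split; rewrite /= /P.
- move=> a1 a2; split=> [[_ [_ [u [u' [v [v' [_ _ uu' _ [-> -> _ _]]]]]]]]|a12].
    apply: con_trans (con_sym (con_alg_rel u)) _; rewrite uu'.
    exact: con_alg_rel.
  have [u [u' [v [v' [? ? ? ? [<- <-]]]]]] := graph_bridge siA siB abA abB dA dB HH a12.
  by exists (con_snd v), (con_snd v'), u, u', v, v'.
- move=> b1 b2; split=> [[_ [_ [u [u' [v [v' [_ _ _ vv' [_ _ -> ->]]]]]]]]|b12].
    apply: con_trans (con_sym (con_alg_rel v)) _; rewrite vv'.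
    exact: con_alg_rel.
  have [v [v' [u [u' [? ? ? ? [<- <-]]]]]] :=
    graph_bridge siB siA abB abA dB dA (quot_graph_flip HH) b12.
  by exists (con_snd u), (con_snd u'), u, u', v, v'.
- move=> _ _ _ _ [u [u' [v [v' [uv uv' uu' vv' [-> -> -> ->]]]]]].
  (* Equal second coordinates give [u = u']; then [v] and [v'] are Delta-related with a common first
     coordinate, hence equal. The converse is symmetric. *)
  split=> [e|e].
    have e' := con_alg_ext uu' e; subst u'.
    suff -> : v = v' by []; apply: (Delta_inj dB) vv'.
    by apply/((Heq _ _ _ _ uv).1 uv'); exact: con_refl.
  have e' := con_alg_ext vv' e; subst v'.
  suff -> : u = u' by []; apply: (Delta_inj dA) uu'.
  by apply/((Heq _ _ _ _ uv).1 uv'); exact: con_refl.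
- move=> _ _ _ _ [u [u' [v [v' [uv uv' uu' vv' [-> -> -> ->]]]]]].
  by split; [exists u, u, v, v|exists u', u', v', v'].
Qed.

End SimilarBridge.

Lemma similar_bridge A B : V A -> V B ->
  subdirectly_irreducible A -> subdirectly_irreducible B -> similar A B ->
  exists T : subuniverse (prod_alg (prod_alg A A) (prod_alg B B)),
    similarity_bridge T.
Proof.
move=> VA VB siA siB; rewrite /similar /difference_algebra.
case: pselect => [abA|nA]; case: pselect => [abB|nB] /= H.
- exact: abelian_similar_bridge.
- by case: nB; apply: iso_difference_abelian VA siA (isomorphic_sym H) abA.
- by case: nA; apply: iso_difference_abelian VB siB H abB.
- exact: iso_bridge.
Qed.

(** * From a bridge to a subdirect product *)

Lemma bridge_subdirect A B (T : subuniverse (prod_alg (prod_alg A A) (prod_alg B B))) :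
  V A -> V B -> subdirectly_irreducible A -> subdirectly_irreducible B ->
  similarity_bridge T ->
  exists (C : subuniverse (prod_alg A B)) (C0 : exists x, C x)
         (tau : congruence (subalg C0)),
    [/\ subdirect C0, con_lt con0 tau &
      exists delta1p delta2p : congruence (subalg C0),
        [/\ unique_upper_cover (con_ker (sub_fst C0)) delta1p,
            unique_upper_cover (con_ker (sub_snd C0)) delta2p,
            con_meet tau (con_ker (sub_fst C0)) = con0 /\
            con_meet tau (con_ker (sub_snd C0)) = con0 &
            con_join tau (con_ker (sub_fst C0)) = delta1p /\
            con_join tau (con_ker (sub_snd C0)) = delta2p]].
Proof.
move=> VA VB siA siB br.
have [Tsym Ttrans] : (forall a1 a2 b1 b2,
      T ((a1, a2), (b1, b2)) -> T ((a2, a1), (b2, b1))) /\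
    (forall a1 a2 a3 b1 b2 b3, T ((a1, a2), (b1, b2)) ->
      T ((a2, a3), (b2, b3)) -> T ((a1, a3), (b1, b3))).
  have [abA|nA] := pselect (abelian (monolith A)).
    have abB := bridge_abelian br abA.
    have [dA dB] := (wdt_maltsev VA abA, wdt_maltsev VB abB).
    split; first exact: (bridge_maltsev_sym br dA dB).
    exact: (bridge_maltsev_trans br dA dB).
  have nB : ~ abelian (monolith B) by rewrite -(bridge_abelianE br).
  (* Partners are unique in the nonabelian case, so two diagonal quadruples over a monolith pair
     determine its quadruple. *)
  have Tfun a1 a2 b1 b2 : monolith A a1 a2 -> T ((a1, a1), (b1, b1)) ->
      T ((a2, a2), (b2, b2)) -> T ((a1, a2), (b1, b2)).
    move=> /(bridge_fst br)[b1' [b2' Tb]] T1 T2.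
    have [T1' T2'] := bridge_diag br Tb.
    by rewrite (bridge_functional br nB T1 T1') (bridge_functional br nB T2 T2').
  have mono a1 a2 b1 b2 : T ((a1, a2), (b1, b2)) -> monolith A a1 a2.
    by move=> ?; apply/(bridge_fst br); exists b1, b2.
  split=> [a1 a2 b1 b2 T12|a1 a2 a3 b1 b2 b3 T12 T23].
    have [? ?] := bridge_diag br T12; apply: Tfun => //.
    exact: con_sym (mono _ _ _ _ T12).
  have [? _] := bridge_diag br T12; have [_ ?] := bridge_diag br T23.
  by apply: Tfun => //; apply: con_trans (mono _ _ _ _ T12) (mono _ _ _ _ T23).
pose P (p : prod_alg A B) := T ((p.1, p.1), (p.2, p.2)).
have Pcl o x : (forall i, P (x i)) -> P (@opn _ _ o x).
  by move=> Px; exact: (subu_closed (s := T) Px).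
pose C := Subuniverse Pcl.
have C0 : exists x, C x.
  have [a] := algebra_inhabited A; have [b ?] := bridge_total br a.
  by exists (a, b).
pose r (x y : subalg C0) :=
  T (((sval x).1, (sval y).1), ((sval x).2, (sval y).2)).
have r_refl x : r x x by exact: svalP x.
have r_sym x y : r x y -> r y x by exact: Tsym.
have r_trans x y z : r x y -> r y z -> r x z by exact: Ttrans.
have r_opn o x y : (forall i, r (x i) (y i)) -> r (opn o x) (opn o y).
  by move=> xy; exact: (subu_closed (s := T) xy).
pose tau := Congruence r_refl r_sym r_trans r_opn.
have mk a b : T ((a, a), (b, b)) -> exists x : subalg C0, sval x = (a, b).
  by move=> Tab; exists (exist _ (a, b) Tab).
have rE (x y : subalg C0) a b a' b' : sval x = (a, b) -> sval y = (a', b') ->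
    r x y = T ((a, a'), (b, b')) by rewrite /r => -> ->.
have on1 : onto (sub_fst C0).
  by move=> a; have [b /mk[x xE]] := bridge_total br a; exists x; rewrite /= xE.
have on2 : onto (sub_snd C0).
  move=> b; have [a /mk[x xE]] := bridge_total (bridge_swapP br) b.
  by exists x; rewrite /= xE.
exists C, C0, tau; split=> //.
  split=> [x y <-|e]; first exact: r_refl.
  have [/con_neq0[a [a' [/(bridge_fst br)[b [b' Tab]] na]]] _] := monolithP siA.
  have [/mk[x xE] /mk[y yE]] := bridge_diag br Tab.
  have : r x y by rewrite (rE _ _ _ _ _ _ xE yE).
  change (tau x y -> False); rewrite -e => /= xy.
  by apply: na; move: xE; rewrite xy yE => -[].
exists (con_pull (sub_fst C0) (monolith A)), (con_pull (sub_snd C0) (monolith B)).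
split; [exact: ker_cover|exact: ker_cover| |].
- split; apply: con_ext => x y; split=> [[xy e]|->].
  + case: x y xy e => -[a b] p [[a' b'] p'] xy /= e; subst a'.
    by apply: eq_exist; congr pair; apply/(bridge_eq br xy).
  + by split=> //; exact: r_refl.
  + case: x y xy e => -[a b] p [[a' b'] p'] xy /= e; subst b'.
    by apply: eq_exist; congr pair; apply/(bridge_eq br xy).
  + by split=> //; exact: r_refl.
split; apply: con_ext => x y; split=> [|xy].
- apply=> phi [->|->] {}x {}y xy; last by move: xy => /= ->; exact: (con_refl (monolith A)).
  by apply/(bridge_fst br); exists (sval x).2, (sval y).2.
(* A pair in the pullback of the monolith is joined by a kernel step, a [tau] step and a kernel
   step, through the diagonal points of a bridge quadruple. *)
- move=> phi /[dup] /(_ tau (or_introl erefl)) tau_phi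
             /(_ _ (or_intror erefl)) ker_phi.
  have /(bridge_fst br)[b [b' Tab]] := xy.
  have [/mk[x' xE] /mk[y' yE]] := bridge_diag br Tab.
  apply: (@con_trans _ _ _ _ x'); first by apply: ker_phi; rewrite /= xE.
  apply: (@con_trans _ _ _ _ y'); last by apply: ker_phi; rewrite /= yE.
  by apply: tau_phi; rewrite /= (rE _ _ _ _ _ _ xE yE).
- apply=> phi [->|->] {}x {}y xy; last by move: xy => /= ->; exact: (con_refl (monolith B)).
  by apply/(bridge_snd br); exists (sval x).1, (sval y).1.
- move=> phi /[dup] /(_ tau (or_introl erefl)) tau_phi
             /(_ _ (or_intror erefl)) ker_phi.
  have /(bridge_snd br)[a [a' Tab]] := xy.
  have [/mk[x' xE] /mk[y' yE]] := bridge_diag br Tab.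
  apply: (@con_trans _ _ _ _ x'); first by apply: ker_phi; rewrite /= xE.
  apply: (@con_trans _ _ _ _ y'); last by apply: ker_phi; rewrite /= yE.
  by apply: tau_phi; rewrite /= (rE _ _ _ _ _ _ xE yE).
Qed.

(** * From the congruences [psi] and [tau] of C to a bridge *)

Section Perspectivity.
Variables (C : algebra S) (psi tau : congruence C).
Hypotheses (VC : V C) (psi_tau : con_lt psi tau).

(** This is the part of (2) about one map, with the join in place of the upper cover; both maps are
    then treated alike. *)
Definition perspective_to A (f : hom C A) :=
  [/\ subdirectly_irreducible A, onto f,
      con_meet tau (con_ker f) = psi &
      unique_upper_cover (con_ker f) (con_join tau (con_ker f))].

Let image A (f : hom C A) a a' := exists x y, [/\ tau x y, f x = a & f y = a'].

Lemma perspective_meet A (f : hom C A) x y : perspective_to f -> tau x y ->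
  psi x y <-> f x = f y.
Proof. by move=> [_ _ <- _] xy; split=> [[]|]. Qed.

(** By uniqueness the upper cover of the kernel is the pullback of the monolith, and as a join it
    contains [tau]. *)
Lemma perspective_monolith A (f : hom C A) x y : perspective_to f -> tau x y ->
  monolith A (f x) (f y).
Proof.
move=> [siA onf _ [cov _]] xy; have [_ /(_ _ cov) E] := ker_cover siA onf.
change (con_pull f (monolith A) x y); rewrite -E => phi /(_ tau (or_introl erefl)).
exact.
Qed.

(** The identities for [d] hold on [tau] modulo [psi], hence after applying [f]. They make the image
    of [tau] transitive, so it is a nonzero congruence below the monolith. *)
Lemma perspective_image A (f : hom C A) : perspective_to f ->
  centralizes tau tau psi ->
  forall a a', image f a a' <-> monolith A a a'.
Proof.
move=> pf ab; have [siA onf meetE _] := pf.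
have dM x y : tau x y ->
    f (eval3 d x x y) = f y /\ f (eval3 d y x x) = f y.
  move=> xy; have [_ /(_ _ _ psi_tau.1 ab _ _ xy)[d1 d2]] := wdt VC.
  have psi_f u v : psi u v -> f u = f v by rewrite -meetE => -[].
  by split; [exact: psi_f|exact/esym/psi_f].
have image_trans a b c : image f a b -> image f b c -> image f a c.
  move=> [x [y [xy <- <-]]] [y' [z [yz e <-]]].
  (* The points [y] and [y'] share an image but may differ in C; [d] merges the two [tau]-pairs into
     one. *)
  exists (eval3 d x y y'), (eval3 d y y z); split.
  - by apply: con_eval3 => //; exact: con_refl.
  - by rewrite eval3_hom e -eval3_hom; have [_ ->] := dM _ _ (con_sym xy).
  - by rewrite eval3_hom -e -eval3_hom; have [->] := dM _ _ yz.
have image_refl a : image f a a.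
  by have [x <-] := onf a; exists x, x; split=> //; exact: con_refl.
have image_sym a b : image f a b -> image f b a.
  by move=> [x [y [xy <- <-]]]; exists y, x; split=> //; exact: con_sym.
have image_opn o x y :
    (forall i, image f (x i) (y i)) -> image f (opn o x) (opn o y).
  move=> /choice[u /choice[v uv]]; exists (opn o u), (opn o v).
  by rewrite !hom_is_hom; split; [apply: con_opn|congr opn; apply/funext..] => i;
     case: (uv i).
pose rho := Congruence image_refl image_sym image_trans image_opn.
move=> a a'; split=> [[x [y [xy <- <-]]]|]; first exact: perspective_monolith.
have [x [y [xy nxy]]] : exists x y, tau x y /\ ~ psi x y.
  apply: contrapT => none; case: psi_tau => le; apply; apply: con_ext => x y.
  split=> [|xy]; first exact: le.
  by apply: contrapT => nxy; apply: none; exists x, y.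
apply: (monolith_le (theta := rho) (x := f x) (y := f y)); first by exists x, y.
by move/(perspective_meet pf xy).
Qed.

Lemma image_subu A B (f1 : hom C A) (f2 : hom C B) :
  exists T : subuniverse (prod_alg (prod_alg A A) (prod_alg B B)),
  forall p, T p <-> exists x y, tau x y /\ p = ((f1 x, f1 y), (f2 x, f2 y)).
Proof.
pose P (p : prod_alg (prod_alg A A) (prod_alg B B)) := exists x y,
  tau x y /\ p = ((f1 x, f1 y), (f2 x, f2 y)).
have Pcl o x : (forall i, P (x i)) -> P (@opn _ _ o x).
  move=> /choice[u /choice[v uv]]; exists (opn o u), (opn o v); split.
    by apply: con_opn => i; case: (uv i).
  have -> : x = fun i => ((f1 (u i), f1 (v i)), (f2 (u i), f2 (v i))).
    by apply/funext => i; case: (uv i).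
  by rewrite !hom_is_hom.
by exists (Subuniverse Pcl).
Qed.

(** If two points agree under [f1] but not under [f2], their [f2]-images are linked over the image
    of [tau], so the centralizer of that image contains the monolith of B. Pulled back to C, this
    makes [tau] abelian modulo [psi]. *)
Lemma perspective_ker A B (f1 : hom C A) (f2 : hom C B) :
  perspective_to f1 -> perspective_to f2 -> ~ centralizes tau tau psi ->
  forall x y, f1 x = f1 y -> f2 x = f2 y.
Proof.
move=> p1 p2 nab x0 y0 e1; apply: contrapT => ne2; apply: nab.
have [T TE] := image_subu f1 f2.
have image_refl b : image f2 b b.
  have [_ on2 _ _] := p2.
  by have [x <-] := on2 b; exists x, x; split=> //; exact: con_refl.
have Tdiag x : T ((f1 x, f1 x), (f2 x, f2 x)).
  by apply/TE; exists x, x; split=> //; exact: con_refl.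
have lk : linked (image f2) eq (f2 x0, f2 x0) (f2 y0, f2 y0).
  apply: (@bridge_linked _ A B (image f1) (image f2) T _ _
            (f1 x0) (f2 x0) (f1 y0) (f2 y0)) => //; last by rewrite e1.
    move=> _ _ [x [y [xy <- <-]]]; exists (f1 x), (f1 y).
    by split; [exists x, y|apply/TE; exists x, y].
  move=> _ _ _ _ /TE[x [y [xy [-> -> -> ->]]]].
  by rewrite -(perspective_meet p1 xy) -(perspective_meet p2 xy).
have le := monolith_le (theta := central eq image_refl) lk ne2.
apply/centralizesP.
suff key x y f g : tau x y -> twin tau f g -> psi (f x) (g x) -> psi (f y) (g y).
  by move=> x y xy f g fg; split; apply: key => //; exact: con_sym.
move=> xy fg.
(* The twin over [tau] is pushed forward to B, where the centralizer of the image applies. *)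
have [o x1 x2 x3 x4 H|c e ce|f' [g' [fg' H]]] := @twin_transfer _ B C (image f2) tau
    (fun b b' x y => b = f2 x /\ b' = f2 y) _ _ _ _ fg.
- by rewrite !hom_is_hom; split; congr opn; apply/funext => i; case: (H i).
- by exists (f2 c), (f2 e); split=> //; exists c, e.
have H' z := H _ _ z z (conj erefl erefl).
have tau_fg z : tau (f z) (g z).
  by apply: (twin_con _ fg) => //; exact: con_refl.
rewrite !(perspective_meet p2) //.
have [<- <-] := H' x; have [<- <-] := H' y.
by apply: (le _ _ (perspective_monolith p2 xy) _ _ fg').1.
Qed.

Lemma perspective_bridge A B (f1 : hom C A) (f2 : hom C B) :
  perspective_to f1 -> perspective_to f2 ->
  exists T : subuniverse (prod_alg (prod_alg A A) (prod_alg B B)),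
    similarity_bridge T.
Proof.
move=> p1 p2; have [siA on1 _ _] := p1; have [_ on2 _ _] := p2.
have [ab|nab] := pselect (centralizes tau tau psi); last first.
  apply: iso_bridge siA (iso_con_ker on1 on2 _) => x y.
  by split; exact: perspective_ker nab _ _.
have [T TE] := image_subu f1 f2; exists T; split.
- move=> a a'; rewrite -(perspective_image p1 ab); split.
    by move=> [b [b' /TE[x [y [xy [-> -> _ _]]]]]]; exists x, y.
  by move=> [x [y [xy <- <-]]]; exists (f2 x), (f2 y); apply/TE; exists x, y.
- move=> b b'; rewrite -(perspective_image p2 ab); split.
    by move=> [a [a' /TE[x [y [xy [_ _ -> ->]]]]]]; exists x, y.
  by move=> [x [y [xy <- <-]]]; exists (f1 x), (f1 y); apply/TE; exists x, y.
- move=> _ _ _ _ /TE[x [y [xy [-> -> -> ->]]]].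
  by rewrite -(perspective_meet p1 xy) -(perspective_meet p2 xy).
- move=> _ _ _ _ /TE[x [y [xy [-> -> -> ->]]]].
  by split; apply/TE; [exists x, x|exists y, y]; split=> //; exact: con_refl.
Qed.

End Perspectivity.
End WeakDifferenceTerm.

Theorem theorem7p7 (S : signature) (V : algebra S -> Prop)
    (V_variety : variety V)
    (V_wdt : exists d : term S 'I_3, weak_difference_term V d)
    (A B : algebra S) (VA : V A) (VB : V B)
    (siA : subdirectly_irreducible A) (siB : subdirectly_irreducible B) :
  [<-> similar A B;
       exists (C : algebra S) (f1 : hom C A) (f2 : hom C B)
              (psi tau : congruence C),
         [/\ V C, onto f1, onto f2, con_lt psi tau &
           exists delta1p delta2p : congruence C,
             [/\ unique_upper_cover (con_ker f1) delta1p,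
                 unique_upper_cover (con_ker f2) delta2p,
                 con_meet tau (con_ker f1) = psi /\
                 con_meet tau (con_ker f2) = psi &
                 con_join tau (con_ker f1) = delta1p /\
                 con_join tau (con_ker f2) = delta2p]];
       exists (C : subuniverse (prod_alg A B)) (C0 : exists x, C x)
              (tau : congruence (subalg C0)),
         [/\ subdirect C0, con_lt con0 tau &
           exists delta1p delta2p : congruence (subalg C0),
             [/\ unique_upper_cover (con_ker (sub_fst C0)) delta1p,
                 unique_upper_cover (con_ker (sub_snd C0)) delta2p,
                 con_meet tau (con_ker (sub_fst C0)) = con0 /\
                 con_meet tau (con_ker (sub_snd C0)) = con0 &
                 con_join tau (con_ker (sub_fst C0)) = delta1p /\
                 con_join tau (con_ker (sub_snd C0)) = delta2p]];
       exists T : subuniverse (prod_alg (prod_alg A A) (prod_alg B B)),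
         similarity_bridge T].
Proof.
have [d wdt] := V_wdt.
set P1 := similar A B; set P2 := ex _; set P3 := ex _; set P4 := ex _.
have i14 : P1 -> P4 by exact: (similar_bridge wdt).
have i41 : P4 -> P1 by move=> [T]; exact: (bridge_similar wdt).
have i43 : P4 -> P3 by move=> [T]; exact: (bridge_subdirect wdt).
have i32 : P3 -> P2.
  move=> [C [C0 [tau [[on1 on2] tau0 H]]]].
  exists (subalg C0), (sub_fst C0), (sub_snd C0), con0, tau; split=> //.
  exact/(variety_S V_variety)/(variety_prod V_variety).
have i24 : P2 -> P4.
  move=> [C [f1 [f2 [psi [tau [VC on1 on2 psi_tau
    [delta1p [delta2p [cov1 cov2 [meet1 meet2] [join1 join2]]]]]]]]]].
  subst delta1p delta2p.
  by apply: (perspective_bridge wdt VC psi_tau (f1 := f1) (f2 := f2)).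
tfae; [by move/i14/i43/i32|by move/i24/i43|by move/i32/i24|exact: i41].
Qed.
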